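(* Let $m\ge1$ be fixed (real) and let $G=G(T)$ satisfy $T^\varepsilon\ll G\le T$ for some fixed $\varepsilon>0$. Then, for large $T$, $$\int_T^{2T} J_1^m(t,G)\,{\rm d}t \ll G^{-1-m}\int_{-G\log T}^{G\log T}\left(\int_T^{2T}|E^*(t+x)|^m\,{\rm d}t\right){\rm d}x + T\log^{2m}T .$$
   Context: $\zeta(s)$ denotes the Riemann zeta-function and $\gamma$ Euler's constant. For $t$ real and $G>0$ define $$J_1(t,G)=\frac{1}{\sqrt{\pi}\,G}\int_{-\infty}^{\infty}\bigl|\zeta(\tfrac12+it+iu)\bigr|^{2}\,e^{-(u/G)^2}\,{\rm d}u .$$ Let $d(n)$ be the number of divisors of $n$. Define $$E(T)=\int_0^T|\zeta(\tfrac12+it)|^2\,{\rm d}t - T\Bigl(\log\frac{T}{2\pi}+2\gamma-1\Bigr),\qquad \Delta(x)=\sum_{n\le x}d(n)-x(\log x+2\gamma-1),$$ $$\Delta^*(x)=-\Delta(x)+2\Delta(2x)-\tfrac12\Delta(4x)=\tfrac12\sum_{n\le 4x}(-1)^n d(n)-x(\log x+2\gamma-1),$$ and $E^*(t)=E(t)-2\pi\Delta^*\bigl(\tfrac{t}{2\pi}\bigr)$. The implied constants in $\ll$ may depend on the fixed parameters $m$ and $\varepsilon$ but not on $T$ or $G$. *)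

(* Defs.v *)
From Stdlib Require Import Reals Lra List.
From Coquelicot Require Import Coquelicot.
Open Scope R_scope.

(* n^{-s} for a positive integer n and complex s = (sigma, t):
   n^{-s} = exp(-s ln n) = n^{-sigma} (cos(t ln n) - i sin(t ln n)). *)
Definition npow_neg (n : nat) (s : C) : C :=
  (exp (- fst s * ln (INR n)) * cos (snd s * ln (INR n)),
   - (exp (- fst s * ln (INR n)) * sin (snd s * ln (INR n)))).

Fixpoint eta_partial (N : nat) (s : C) : C :=
  match N with
  | O => 0%C
  | S k => Cplus (eta_partial k s)
             (Cmult (RtoC ((-1) ^ k)) (npow_neg (S k) s))
  end.

(* Dirichlet eta function, as the limit of its partial sums (convergent for Re s > 0). *)
Definition eta (s : C) : C :=
  (real (Lim_seq (fun N => fst (eta_partial N s))),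
   real (Lim_seq (fun N => snd (eta_partial N s)))).

(* Riemann zeta function for Re s > 0, s <> 1 (analytic continuation):
   zeta(s) = eta(s) / (1 - 2^{1-s}),  with 2^{1-s} = 2 * 2^{-s}. *)
Definition zeta (s : C) : C :=
  Cdiv (eta s) (Cminus 1%C (Cmult (RtoC 2) (npow_neg 2 s))).

Definition Z2 (t : R) : R := (Cmod (zeta (/2, t))) ^ 2.

Definition H (n : nat) : R :=
  match n with O => 0 | S k => sum_f_R0 (fun j => / INR (S j)) k end.
Definition euler_gamma : R := real (Lim_seq (fun n => H n - ln (INR n))).

Definition J1 (t G : R) : R :=
  / (sqrt PI * G) *
  RInt_gen (fun u => Z2 (t + u) * exp (- (u / G) ^ 2))
           (Rbar_locally m_infty) (Rbar_locally p_infty).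

Definition E (T : R) : R :=
  RInt Z2 0 T - T * (ln (T / (2 * PI)) + 2 * euler_gamma - 1).

Definition ndiv (n : nat) : nat :=
  length (filter (fun k => Nat.eqb (n mod k) 0) (seq 1 n)).

(* sum_{1 <= n <= x} d(n)  (empty sum when x < 1) *)
Definition D (x : R) : R :=
  sum_f_R0 (fun k => INR (ndiv k)) (Z.to_nat (Int_part x)).

Definition Delta (x : R) : R := D x - x * (ln x + 2 * euler_gamma - 1).

Definition Delta_star (x : R) : R :=
  - Delta x + 2 * Delta (2 * x) - / 2 * Delta (4 * x).

Definition E_star (t : R) : R := E t - 2 * PI * Delta_star (t / (2 * PI)).

Definition rpow (x m : R) : R := if Req_EM_T x 0 then 0 else Rpower x m.

(* Main.v *)
From mathcomp Require prime.
From Stdlib Require Import Reals Lra Lia List ClassicalEpsilon ZArith.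
From Coquelicot Require Import Coquelicot.
Require Import Defs.
Open Scope R_scope.

(** Write [I] for the integral of [Z2] from [0].  The main terms of [E] and [Delta_star]
    cancel, so [E_star = I - A] with [A] a step function carried by the divisor function.
    Truncating [J1] at [|u| <= G ln T] and integrating by parts turns it into an average of
    [I (t + u) - A t] against the odd kernel [2 u / G^2 exp (- (u/G)^2)] (which kills the
    constant [A t]), divided by [G].  Here [I (t + u) - A t] is [E_star (t + u)] plus
    [A (t + u) - A t]; the first part gives the moment of [E_star] by Jensen's inequality and
    an interchange of integrals, and the second is [O ((|u| + G) ln^2 T)] by a bound for
    divisor sums over intervals as short as [x^d].

    For the latter, factor [n = b q] by collecting the smallest primes of [n] into
    [b <= z = x^(d/2)] for as long as possible, and let [p] be the least prime of [q].  If
    [p > sqrt z] then [q] has boundedly many prime factors; summing [ndiv b / b] over [b <= z]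
    costs [ln^2 x].  Otherwise [b > sqrt z] is [p]-smooth, which Rankin's method shows to be
    rare enough to pay for [ndiv q] (no sieve is needed because the loss of one logarithm with
    respect to Shiu's theorem is allowed). *)

(** * Finite sums and divisors *)

(** Since [G] may be as small as a fixed power of [T], the pointwise bound [ndiv n] <= C n^e is too
    weak for the steps of A: it would lose a small power of T where only ln^2 T is allowed. The
    delicate case is a small least prime p. Rankin's gain is chosen larger than [ndiv q] requires,
    and the surplus supplies a factor ln p / ln z. Counting multiples of b p contributes 1/p, so the
    sum over p becomes (1 / ln z) times the sum of ln p / p, which is bounded by the upper half of
    Mertens' theorem and costs no logarithm. The Rankin exponent is of order 1 / ln p, so q^h stays
    bounded for all primes q <= p, and the smooth sums exceed the harmonic sum by at most a constant
    factor, uniformly in p. All integrals are Riemann integrals of functions given by limits with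
    default values, so continuity of zeta, convergence of [J1] and integrability of [E_star] must be
    established. Crude polynomial bounds in t are enough there, because the Gaussian at |u| = G ln T
    is exp(-ln^2 T). Its derivative is majorized by a Cauchy kernel, which has an elementary
    primitive and is a positive weight for Jensen's inequality. *)

Definition ind (P : Prop) : R := if excluded_middle_informative P then 1 else 0.

Lemma ind_true (P : Prop) : P -> ind P = 1.
Proof. intros h; unfold ind; destruct (excluded_middle_informative P); tauto. Qed.

Lemma ind_false (P : Prop) : ~ P -> ind P = 0.
Proof. intros h; unfold ind; destruct (excluded_middle_informative P); tauto. Qed.

Lemma ind_bounds (P : Prop) : 0 <= ind P <= 1.
Proof. unfold ind; destruct (excluded_middle_informative P); lra. Qed.

Lemma ind_le (P Q : Prop) : (P -> Q) -> ind P <= ind Q.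
Proof.
  intros h; unfold ind.
  destruct (excluded_middle_informative P), (excluded_middle_informative Q); lra || tauto.
Qed.

(** Starting at 1 keeps 0, which every number divides, out of all divisor sums. *)
Fixpoint sum1 (f : nat -> R) (N : nat) : R :=
  match N with O => 0 | S k => sum1 f k + f (S k) end.

Lemma sum1_le (f g : nat -> R) (N : nat) :
  (forall k, (1 <= k <= N)%nat -> f k <= g k) -> sum1 f N <= sum1 g N.
Proof.
  induction N as [|N IH]; simpl; intros h; [lra|].
  assert (h1 := h (S N) ltac:(lia)).
  assert (h2 : sum1 f N <= sum1 g N) by (apply IH; intros; apply h; lia). lra.
Qed.

Lemma sum1_ext (f g : nat -> R) (N : nat) :
  (forall k, (1 <= k <= N)%nat -> f k = g k) -> sum1 f N = sum1 g N.
Proof. intros h; apply Rle_antisym; apply sum1_le; intros k hk; rewrite (h k hk); lra. Qed.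

Lemma sum1_plus (f g : nat -> R) (N : nat) :
  sum1 (fun k => f k + g k) N = sum1 f N + sum1 g N.
Proof. induction N as [|N IH]; simpl; lra. Qed.

Lemma sum1_scal (c : R) (f : nat -> R) (N : nat) :
  sum1 (fun k => c * f k) N = c * sum1 f N.
Proof. induction N as [|N IH]; simpl; [ring|rewrite IH; ring]. Qed.

Lemma sum1_zero (N : nat) : sum1 (fun _ => 0) N = 0.
Proof. induction N as [|N IH]; simpl; lra. Qed.

Lemma sum1_nonneg (f : nat -> R) (N : nat) :
  (forall k, (1 <= k <= N)%nat -> 0 <= f k) -> 0 <= sum1 f N.
Proof. intros h; rewrite <- (sum1_zero N); apply sum1_le, h. Qed.

Lemma sum1_switch (f : nat -> nat -> R) (N M : nat) :
  sum1 (fun i => sum1 (fun j => f i j) M) N = sum1 (fun j => sum1 (fun i => f i j) N) M.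
Proof.
  induction N as [|N IH]; simpl; [now rewrite sum1_zero|].
  now rewrite IH, <- sum1_plus.
Qed.

Lemma sum1_mono (f : nat -> R) (N M : nat) :
  (forall k, 0 <= f k) -> (N <= M)%nat -> sum1 f N <= sum1 f M.
Proof.
  intros h hNM; induction hNM as [|M _ IH]; [lra|]. simpl; specialize (h (S M)); lra.
Qed.

Lemma sum1_term (f : nat -> R) (k N : nat) :
  (forall j, 0 <= f j) -> (1 <= k <= N)%nat -> f k <= sum1 f N.
Proof.
  intros h hk; apply Rle_trans with (sum1 f k); [|apply sum1_mono; [exact h|lia]].
  destruct k as [|k]; [lia|]; simpl.
  assert (0 <= sum1 f k) by (apply sum1_nonneg; auto). lra.
Qed.

Lemma sum1_ind_eq (a N : nat) : (1 <= a <= N)%nat -> sum1 (fun k => ind (a = k)) N = 1.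
Proof.
  induction N as [|N IH]; intros h; [lia|]; simpl.
  destruct (Nat.eq_dec a (S N)) as [e|e].
  - subst a; rewrite ind_true by reflexivity.
    rewrite (sum1_ext _ (fun _ => 0)), sum1_zero; [lra|].
    intros k hk; apply ind_false; lia.
  - rewrite IH by lia; rewrite ind_false by assumption; lra.
Qed.

Lemma sum1_ind_eq_le (a N : nat) : sum1 (fun k => ind (a = k)) N <= 1.
Proof.
  induction N as [|N IH]; simpl; [lra|].
  destruct (Nat.eq_dec a (S N)) as [e|e].
  - subst a; rewrite ind_true by reflexivity.
    rewrite (sum1_ext _ (fun _ => 0)), sum1_zero; [lra|].
    intros k hk; apply ind_false; lia.
  - rewrite (ind_false (a = S N)) by assumption; lra.
Qed.

(** Every multiple b <= N of i is i j for some j <= N. The products i j beyond N only enlarge the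
    right side, as f is nonnegative. *)
Lemma sum1_multiples (i N : nat) (f : nat -> R) :
  (forall n, 0 <= f n) ->
  sum1 (fun b => ind (Nat.divide i b) * f b) N <= sum1 (fun j => f (i * j)%nat) N.
Proof.
  intros hf.
  apply Rle_trans with
    (sum1 (fun b => sum1 (fun j => f (i * j)%nat * ind ((i * j)%nat = b)) N) N).
  - apply sum1_le; intros b hb.
    destruct (excluded_middle_informative (Nat.divide i b)) as [[j hj]|h].
    + assert (hj' : (1 <= j <= N)%nat) by (destruct j, i; nia).
      apply Rle_trans with (f (i * j)%nat * ind ((i * j)%nat = b)).
      * replace (i * j)%nat with b by lia.
        rewrite ind_true by (exists j; lia); rewrite ind_true by reflexivity; lra.
      * apply (sum1_term (fun j => f (i * j)%nat * ind ((i * j)%nat = b)));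
          [intros; apply Rmult_le_pos; [apply hf|apply ind_bounds]|exact hj'].
    + rewrite ind_false by assumption; rewrite Rmult_0_l.
      apply sum1_nonneg; intros; apply Rmult_le_pos; [apply hf|apply ind_bounds].
  - rewrite sum1_switch; apply sum1_le; intros j hj; rewrite sum1_scal.
    assert (h := sum1_ind_eq_le (i * j) N); specialize (hf (i * j)%nat); nra.
Qed.

Lemma ndiv_sum (n : nat) : INR (ndiv n) = sum1 (fun k => ind (Nat.divide k n)) n.
Proof.
  unfold ndiv.
  assert (h : forall (p : nat -> bool) N,
    INR (length (filter p (seq 1 N))) = sum1 (fun k => if p k then 1 else 0) N).
  { intros p N; induction N as [|N IH]; [reflexivity|].
    rewrite seq_S, filter_app, length_app, plus_INR, IH; simpl.
    now destruct (p (S N)). }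
  rewrite h; apply sum1_ext; intros k hk.
  destruct (Nat.eqb_spec (n mod k) 0) as [e|e].
  - rewrite ind_true; [reflexivity|]. apply Nat.Lcm0.mod_divide; exact e.
  - rewrite ind_false; [reflexivity|]. intros hd; apply e, Nat.Lcm0.mod_divide, hd.
Qed.

Lemma ndiv_nonneg (n : nat) : 0 <= INR (ndiv n).
Proof. apply pos_INR. Qed.

Lemma ndiv_le_sum (n N : nat) : (n <= N)%nat ->
  INR (ndiv n) <= sum1 (fun k => ind (Nat.divide k n)) N.
Proof. intros h; rewrite ndiv_sum; apply sum1_mono; [intros; apply ind_bounds|exact h]. Qed.

(** With g = gcd (k, a), the cofactor k / g is coprime to a / g and divides (a / g) b, hence divides
    b by Gauss's lemma. *)
Lemma divide_mul_split (k a b : nat) : (1 <= a)%nat -> (1 <= k)%nat ->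
  Nat.divide k (a * b) -> exists i j, Nat.divide i a /\ Nat.divide j b /\ k = (i * j)%nat.
Proof.
  intros ha hk [c hc].
  set (g := Nat.gcd k a).
  assert (hg : g <> 0%nat) by (intros e; apply Nat.gcd_eq_0 in e; lia).
  destruct (Nat.gcd_divide_l k a) as [k' hk']; fold g in hk'.
  destruct (Nat.gcd_divide_r k a) as [a' ha']; fold g in ha'.
  exists g, k'; repeat split; [exists a'; lia| |lia].
  apply (Nat.gauss k' a' b).
  - exists c. apply (Nat.mul_cancel_l _ _ g hg). nia.
  - assert (e := Nat.gcd_div_gcd k a g hg eq_refl).
    rewrite hk' in e at 1; rewrite ha' in e at 1.
    now rewrite !Nat.div_mul in e by assumption.
Qed.

(** The products of a divisor of a and a divisor of b cover the divisors of a b, possibly with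
    repetition, so counting pairs gives an inequality for arbitrary a and b. *)
Lemma ndiv_mul_le (a b : nat) : (1 <= a)%nat -> (1 <= b)%nat ->
  INR (ndiv (a * b)) <= INR (ndiv a) * INR (ndiv b).
Proof.
  intros ha hb.
  rewrite !ndiv_sum.
  apply Rle_trans with
   (sum1 (fun k => sum1 (fun i => sum1 (fun j =>
      (ind (Nat.divide i a) * ind (Nat.divide j b)) * ind ((i * j)%nat = k)) b) a) (a * b)).
  - assert (hp : forall k i j,
      0 <= ind (Nat.divide i a) * ind (Nat.divide j b) * ind ((i * j)%nat = k)).
    { intros; repeat apply Rmult_le_pos; apply ind_bounds. }
    apply sum1_le; intros k hk.
    destruct (excluded_middle_informative (Nat.divide k (a * b))) as [h|h].
    + rewrite ind_true by assumption.
      destruct (divide_mul_split k a b ha ltac:(lia) h) as (i & j & hi & hj & e).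
      assert (hi' := Nat.divide_pos_le i a ltac:(lia) hi).
      assert (hj' := Nat.divide_pos_le j b ltac:(lia) hj).
      assert (1 <= i)%nat by (destruct i; nia). assert (1 <= j)%nat by (destruct j; nia).
      eapply Rle_trans; [|apply (sum1_term _ i)];
        [|intros; apply sum1_nonneg; intros; apply hp|lia].
      eapply Rle_trans; [|apply (sum1_term _ j)]; [|intros; apply hp|lia].
      rewrite !ind_true by auto; lra.
    + rewrite ind_false by assumption.
      apply sum1_nonneg; intros; apply sum1_nonneg; intros; apply hp.
  - rewrite sum1_switch, Rmult_comm, <- sum1_scal; apply sum1_le; intros i hi.
    rewrite sum1_switch, Rmult_comm, <- sum1_scal; apply sum1_le; intros j hj.
    rewrite sum1_scal.
    assert (h := sum1_ind_eq_le (i * j) (a * b)).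
    assert (0 <= ind (Nat.divide i a) * ind (Nat.divide j b)) by
      (apply Rmult_le_pos; apply ind_bounds). nra.
Qed.

(** * Primes and valuations *)

Notation is_prime p := (prime.prime p = true).

Lemma dvdn_divide (d n : nat) : div.dvdn d n = true <-> Nat.divide d n.
Proof.
  split; intros h.
  - destruct (ssrbool.elimT div.dvdnP h) as [k hk]; now exists k.
  - destruct h as [k hk]; apply (ssrbool.introT div.dvdnP); now exists k.
Qed.

Lemma prime_ge_2 (p : nat) : is_prime p -> (2 <= p)%nat.
Proof. intros h; exact (ssrbool.elimT ssrnat.leP (prime.prime_gt1 h)). Qed.

Lemma prime_divisor (p d : nat) : is_prime p -> Nat.divide d p -> d = 1%nat \/ d = p.
Proof.
  intros h hd. destruct (ssrbool.elimT prime.primeP h) as [_ h'].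
  apply dvdn_divide in hd. specialize (h' d hd).
  destruct (ssrbool.elimT ssrbool.orP h') as [e|e];
    [left|right]; exact (ssrbool.elimT eqtype.eqP e).
Qed.

Lemma prime_euclid (p a b : nat) : is_prime p -> Nat.divide p (a * b) ->
  Nat.divide p a \/ Nat.divide p b.
Proof.
  intros h hd; apply dvdn_divide in hd.
  change (a * b)%nat with (ssrnat.muln a b) in hd.
  rewrite (prime.Euclid_dvdM _ _ h) in hd.
  destruct (ssrbool.elimT ssrbool.orP hd); [left|right]; now apply dvdn_divide.
Qed.

Lemma least_prime (n : nat) : (2 <= n)%nat -> exists p, is_prime p /\ Nat.divide p n /\
  forall r, is_prime r -> Nat.divide r n -> (p <= r)%nat.
Proof.
  intros h.
  assert (h1 : is_true (ssrnat.leq 2 n)) by (apply (ssrbool.introT ssrnat.leP); lia).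
  exists (prime.pdiv n); repeat split.
  - apply (prime.pdiv_prime h1).
  - apply dvdn_divide, prime.pdiv_dvd.
  - intros r hr hd. apply (ssrbool.elimT ssrnat.leP).
    apply prime.pdiv_min_dvd; [exact (prime.prime_gt1 hr)|now apply dvdn_divide].
Qed.

Lemma logn_prime_mul (q r b : nat) : is_prime r -> (1 <= b)%nat ->
  INR (prime.logn q (r * b)) = ind (q = r) + INR (prime.logn q b).
Proof.
  intros hr hb.
  change (r * b)%nat with (ssrnat.muln r b).
  rewrite prime.lognM; [|exact (prime.prime_gt0 hr)|apply (ssrbool.introT ssrnat.leP); lia].
  rewrite (prime.logn_prime _ hr).
  change ssrnat.addn with Nat.add; rewrite plus_INR; f_equal.
  destruct (Nat.eq_dec q r) as [e|e].
  - subst; rewrite eqtype.eqxx, ind_true; reflexivity.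
  - rewrite ind_false by assumption.
    match goal with |- context [ssrnat.nat_of_bool ?c] => assert (hc : c = false) end.
    { apply (ssrbool.introF eqtype.eqP e). }
    rewrite hc; reflexivity.
Qed.

Lemma logn_ndvd (q b : nat) : ~ Nat.divide q b -> prime.logn q b = 0%nat.
Proof.
  intros h; rewrite prime.lognE.
  replace (div.dvdn q b) with false; [now rewrite !Bool.andb_false_r|].
  symmetry; apply Bool.not_true_is_false; intros e; now apply h, dvdn_divide.
Qed.

(** * Smooth numbers *)

Lemma INR_ge_1 (n : nat) : (1 <= n)%nat -> 1 <= INR n.
Proof. intros h; replace 1 with (INR 1) by reflexivity; now apply le_INR. Qed.

Lemma exp_le_compat (x y : R) : x <= y -> exp x <= exp y.
Proof.
  intros [h|h]; [apply Rlt_le, exp_increasing, h|rewrite h; apply Rle_refl].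
Qed.

Lemma ln_INR_nonneg (n : nat) : 0 <= ln (INR n).
Proof.
  destruct n as [|n].
  - simpl; unfold ln; destruct (Rlt_dec 0 0) as [h|h]; [exfalso; lra|apply Rle_refl].
  - rewrite <- ln_1; apply ln_le; [lra|apply INR_ge_1; lia].
Qed.

Lemma ln_le_sub_1 (x : R) : 0 < x -> ln x <= x - 1.
Proof.
  intros hx; assert (h := exp_ineq1_le (ln x)); rewrite exp_ln in h by assumption; lra.
Qed.

Lemma sum1_inv_le (N : nat) : (1 <= N)%nat -> sum1 (fun b => / INR b) N <= 1 + ln (INR N).
Proof.
  induction N as [|N IH]; intros h; [lia|].
  destruct N as [|N]; [simpl; rewrite ln_1; lra|].
  change (sum1 (fun b => / INR b) (S (S N))) with
    (sum1 (fun b => / INR b) (S N) + / INR (S (S N))).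
  specialize (IH ltac:(lia)).
  assert (h1 := INR_ge_1 (S N) ltac:(lia)).
  rewrite (S_INR (S N)).
  set (a := INR (S N)) in *.
  (* At this point ln x <= x - 1 reads 1 / (a + 1) <= ln (a + 1) - ln a, which is the induction
     step. *)
  assert (h2 := ln_le_sub_1 (a / (a + 1)) ltac:(apply Rdiv_lt_0_compat; lra)).
  unfold Rdiv in h2. rewrite ln_mult, ln_Rinv in h2 by (try apply Rinv_0_lt_compat; lra).
  replace (a * / (a + 1) - 1) with (- / (a + 1)) in h2 by (field; lra). lra.
Qed.

(** The prime factorization in logarithmic form. The range N only has to cover the prime factors of
    b, so that for a p-smooth b the sum can stop at p. *)
Lemma ln_sum_logn (b N : nat) : (1 <= b)%nat ->
  (forall q, is_prime q -> Nat.divide q b -> (q <= N)%nat) ->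
  ln (INR b) = sum1 (fun q => ind (is_prime q) * INR (prime.logn q b) * ln (INR q)) N.
Proof.
  induction b as [b IH] using (well_founded_induction Wf_nat.lt_wf); intros hb hN.
  destruct (Nat.eq_dec b 1) as [e|e].
  - subst b; rewrite (sum1_ext _ (fun _ => 0)), sum1_zero; [apply ln_1|].
    intros k hk; rewrite prime.logn1; simpl; ring.
  - destruct (least_prime b ltac:(lia)) as (r & hr & [b' hb'] & _).
    assert (hr2 := prime_ge_2 r hr).
    assert (1 <= b')%nat by (destruct b'; lia).
    replace b with (r * b')%nat by lia.
    rewrite mult_INR, ln_mult by (apply lt_0_INR; lia).
    rewrite (IH b' ltac:(nia) ltac:(lia))
      by (intros q hq [c hc]; apply hN; [exact hq|exists (c * r)%nat; nia]).
    rewrite (sum1_ext (fun q => ind (is_prime q) * INR (prime.logn q (r * b')) * ln (INR q))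
      (fun q => ln (INR r) * ind (r = q) +
                ind (is_prime q) * INR (prime.logn q b') * ln (INR q))).
    + rewrite sum1_plus, sum1_scal, sum1_ind_eq; [ring|].
      split; [lia|apply hN; [exact hr|now exists b']].
    + intros q hq; rewrite logn_prime_mul by (assumption || lia).
      destruct (Nat.eq_dec q r) as [e1|e1].
      * subst q; rewrite !ind_true by (reflexivity || assumption); ring.
      * rewrite (ind_false (q = r)), (ind_false (r = q)) by congruence; ring.
Qed.

Lemma count_multiples (e n : nat) : (1 <= e)%nat ->
  sum1 (fun k => ind (Nat.divide e k)) n = INR (n / e).
Proof.
  intros he; induction n as [|n IH]; [rewrite Nat.Div0.div_0_l; reflexivity|].
  simpl sum1; rewrite IH.
  assert (h1 := Nat.div_mod_eq n e). assert (h1' := Nat.mod_upper_bound n e ltac:(lia)).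
  assert (h2 := Nat.div_mod_eq (S n) e).
  assert (h2' := Nat.mod_upper_bound (S n) e ltac:(lia)).
  destruct (excluded_middle_informative (Nat.divide e (S n))) as [h|h].
  - rewrite ind_true by assumption; rewrite <- S_INR; f_equal.
    apply Nat.Lcm0.mod_divide in h. nia.
  - rewrite ind_false by assumption; rewrite Rplus_0_r; f_equal.
    assert (S n mod e <> 0)%nat by (intros h3; apply h, Nat.Lcm0.mod_divide, h3). nia.
Qed.

Lemma INR_div_bounds (n e : nat) : (1 <= e)%nat ->
  INR n / INR e - 1 < INR (n / e) <= INR n / INR e.
Proof.
  intros he.
  assert (h1 := Nat.div_mod_eq n e). assert (h1' := Nat.mod_upper_bound n e ltac:(lia)).
  assert (h2 : INR n = INR e * INR (n / e) + INR (n mod e)) by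
    (rewrite <- mult_INR, <- plus_INR; now f_equal).
  assert (h3 := INR_ge_1 e he).
  apply lt_INR in h1'. assert (h4 := pos_INR (n mod e)).
  assert (h5 : INR n / INR e = INR (n / e) + INR (n mod e) / INR e) by
    (rewrite h2 at 1; field; lra).
  assert (0 <= INR (n mod e) / INR e) by (apply Rle_mult_inv_pos; lra).
  assert (INR (n mod e) / INR e < 1) by (apply Rlt_div_l; lra).
  lra.
Qed.

Lemma sum1_shift (f : nat -> R) (N M : nat) :
  sum1 (fun k => f (N + k)%nat) M = sum1 f (N + M) - sum1 f N.
Proof.
  induction M as [|M IH]; simpl; [rewrite Nat.add_0_r; ring|].
  rewrite IH, Nat.add_succ_r; simpl; ring.
Qed.

Lemma count_multiples_interval (e N M : nat) : (1 <= e)%nat ->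
  sum1 (fun k => ind (Nat.divide e (N + k))) M <= INR M / INR e + 1.
Proof.
  intros he; rewrite (sum1_shift (fun k => ind (Nat.divide e k))).
  rewrite !count_multiples by assumption.
  assert (h1 := INR_div_bounds (N + M) e he). assert (h2 := INR_div_bounds N e he).
  rewrite plus_INR, Rdiv_plus_distr in h1. lra.
Qed.

Lemma logn_ge_ind (q b : nat) : is_prime q -> (1 <= b)%nat ->
  ind (Nat.divide q b) <= INR (prime.logn q b).
Proof.
  intros hq hb.
  destruct (excluded_middle_informative (Nat.divide q b)) as [h|h].
  - rewrite ind_true by assumption; destruct h as [c hc].
    replace b with (q * c)%nat by lia.
    rewrite logn_prime_mul by (assumption || (destruct c; lia)).
    rewrite ind_true by reflexivity. assert (h := pos_INR (prime.logn q c)). lra.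
  - rewrite ind_false by assumption; apply pos_INR.
Qed.

(* Each prime [q <= n] divides at least [n / (2 q)] of the factors of [n!]. *)
Lemma mertens_upper (n : nat) : (1 <= n)%nat ->
  sum1 (fun q => ind (is_prime q) * (ln (INR q) / INR q)) n <= 2 * ln (INR n).
Proof.
  intros hn.
  assert (h1 : sum1 (fun k => ln (INR k)) n <= INR n * ln (INR n)).
  { clear hn; assert (h : forall m, (m <= n)%nat ->
      sum1 (fun k => ln (INR k)) m <= INR m * ln (INR n)).
    { induction m as [|m IH]; intros hm; [simpl; lra|].
      specialize (IH ltac:(lia)).
      change (sum1 (fun k => ln (INR k)) m + ln (INR (S m)) <= INR (S m) * ln (INR n)).
      assert (ln (INR (S m)) <= ln (INR n)) by
        (apply ln_le; [apply lt_0_INR; lia|now apply le_INR]).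
      assert (e := S_INR m). nra. }
    now apply h. }
  assert (h2 : sum1 (fun q => ind (is_prime q) * ln (INR q) * INR (n / q)) n
               <= sum1 (fun k => ln (INR k)) n).
  { apply Rle_trans with (sum1 (fun k => sum1 (fun q =>
      ind (is_prime q) * ln (INR q) * ind (Nat.divide q k)) n) n).
    - rewrite sum1_switch; apply sum1_le; intros q hq.
      rewrite sum1_scal, count_multiples by lia; lra.
    - apply sum1_le; intros k hk.
      rewrite (ln_sum_logn k n) by
        (lia || (intros q _ hd; apply Nat.divide_pos_le in hd; lia)).
      apply sum1_le; intros q hq.
      destruct (excluded_middle_informative (is_prime q)) as [h|h].
      + rewrite ind_true by assumption.
        assert (h3 := logn_ge_ind q k h ltac:(lia)). assert (h4 := ln_INR_nonneg q). nra.
      + rewrite ind_false by assumption; lra. }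
  assert (h3 : INR n / 2 * sum1 (fun q => ind (is_prime q) * (ln (INR q) / INR q)) n
     <= sum1 (fun q => ind (is_prime q) * ln (INR q) * INR (n / q)) n).
  { rewrite <- sum1_scal; apply sum1_le; intros q hq.
    assert (h4 := INR_div_bounds n q ltac:(lia)).
    (* The integer quotient is at least 1, so the loss of less than 1 in rounding at most halves
       it. *)
    assert (h5 : 1 <= INR (n / q)).
    { apply INR_ge_1, Nat.div_le_lower_bound; lia. }
    assert (h6 : INR n / INR q / 2 <= INR (n / q)) by lra.
    assert (h7 := ln_INR_nonneg q). assert (h8 := ind_bounds (is_prime q)).
    assert (h9 := INR_ge_1 q ltac:(lia)).
    replace (INR n / 2 * (ind (is_prime q) * (ln (INR q) / INR q))) with
      (ind (is_prime q) * ln (INR q) * (INR n / INR q / 2)) by (field; lra).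
    apply Rmult_le_compat_l; [apply Rmult_le_pos; lra|exact h6]. }
  assert (h4 := INR_ge_1 n hn).
  set (S := sum1 _ n) in h3 |- *. nra.
Qed.

Definition smooth (p b : nat) : Prop := forall r, is_prime r -> Nat.divide r b -> (r <= p)%nat.

Lemma smooth_mul_l (p a b : nat) : smooth p (a * b) -> smooth p a.
Proof. intros h r hr [c hc]; apply h; [exact hr|exists (c * b)%nat; nia]. Qed.

Lemma smooth_mul_r (p a b : nat) : smooth p (a * b) -> smooth p b.
Proof. rewrite Nat.mul_comm; apply smooth_mul_l. Qed.

(** The truncated Dirichlet series of the p-smooth numbers at 1 - h, where h is the exponent of
    Rankin's method. *)
Definition smooth_sum (p N : nat) (h : R) : R :=
  sum1 (fun b => ind (smooth p b) * exp ((h - 1) * ln (INR b))) N.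

Lemma exp_ln_mul (s : R) (a b : nat) : (1 <= a)%nat -> (1 <= b)%nat ->
  exp (s * ln (INR (a * b))) = exp (s * ln (INR a)) * exp (s * ln (INR b)).
Proof.
  intros ha hb; rewrite mult_INR, ln_mult by (apply lt_0_INR; lia).
  rewrite <- exp_plus; f_equal; ring.
Qed.

Lemma smooth_sum_nonneg (p N : nat) (h : R) : 0 <= smooth_sum p N h.
Proof.
  apply sum1_nonneg; intros; apply Rmult_le_pos;
    [apply ind_bounds|apply Rlt_le, exp_pos].
Qed.

(* Writing [b = q j] gives [S <= q^(h-1) (F + S)] for the sum [S] on the left. *)
Lemma smooth_sum_logn (p N q : nat) (h : R) : is_prime q -> h <= /4 ->
  sum1 (fun b => ind (smooth p b) * exp ((h - 1) * ln (INR b)) * INR (prime.logn q b)) N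
  <= 4 * exp ((h - 1) * ln (INR q)) * smooth_sum p N h.
Proof.
  intros hq hh.
  set (S := sum1 _ N). set (F := smooth_sum p N h). set (x := exp ((h - 1) * ln (INR q))).
  assert (hq2 := prime_ge_2 q hq).
  assert (h1 : S <= x * (F + S)).
  { unfold F, smooth_sum, S. rewrite <- sum1_plus, <- sum1_scal.
    apply Rle_trans with (sum1 (fun b => ind (Nat.divide q b) *
      (ind (smooth p b) * exp ((h - 1) * ln (INR b)) * INR (prime.logn q b))) N).
    - apply sum1_le; intros b hb.
      destruct (excluded_middle_informative (Nat.divide q b)) as [hd|hd].
      + rewrite (ind_true (Nat.divide q b)) by assumption; lra.
      + rewrite (logn_ndvd q b hd); simpl; lra.
    - eapply Rle_trans; [apply sum1_multiples|].
      + intros; repeat apply Rmult_le_pos;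
          [apply ind_bounds|apply Rlt_le, exp_pos|apply pos_INR].
      + apply sum1_le; intros j hj.
        rewrite exp_ln_mul by lia; rewrite logn_prime_mul by (assumption || lia).
        rewrite ind_true with (P := q = q) by reflexivity. fold x.
        assert (h2 := ind_le (smooth p (q * j)) (smooth p j) (smooth_mul_r p q j)).
        assert (h3 := pos_INR (prime.logn q j)).
        assert (h4 := exp_pos ((h - 1) * ln (INR j))).
        assert (h5 := exp_pos ((h - 1) * ln (INR q))). fold x in h5.
        replace (x * (ind (smooth p j) * exp ((h - 1) * ln (INR j)) +
            ind (smooth p j) * exp ((h - 1) * ln (INR j)) * INR (prime.logn q j)))
          with (ind (smooth p j) * (x * exp ((h - 1) * ln (INR j)) *
             (1 + INR (prime.logn q j)))) by ring.
        rewrite Rmult_assoc; apply Rmult_le_compat_r; [|exact h2].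
        apply Rmult_le_pos; [apply Rmult_le_pos|]; lra. }
  (* From ln q >= 1/2 and h <= 1/4, x <= exp (-3/8) <= 3/4. Hence 1 - x >= 1/4, the source of the
     factor 4. *)
  assert (hx : x <= 3 / 4).
  { assert (hl : ln 2 <= ln (INR q)) by
      (apply ln_le; [lra|]; replace 2 with (INR 2) by reflexivity; now apply le_INR).
    assert (l2 := ln_lt_2).
    apply Rle_trans with (exp (- (3 / 8))).
    - unfold x; apply exp_le_compat; nra.
    - rewrite exp_Ropp; assert (e := exp_ineq1_le (3 / 8)).
      replace (3 / 4) with (/ (4 / 3)) by lra; apply Rinv_le_contravar; lra. }
  assert (h0 : 0 < x) by apply exp_pos.
  assert (hF : 0 <= F) by apply smooth_sum_nonneg.
  assert (hS : S * (1 - x) <= x * F) by lra.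
  assert (hS0 : 0 <= S \/ S < 0) by lra.
  assert (S * / 4 <= x * F) by (destruct hS0; nra). nra.
Qed.

Lemma is_derive_smooth_sum (p N : nat) (h : R) :
  is_derive (smooth_sum p N) h
    (sum1 (fun b => ind (smooth p b) * exp ((h - 1) * ln (INR b)) * ln (INR b)) N).
Proof.
  unfold smooth_sum; induction N as [|N IH]; simpl sum1.
  - apply is_derive_Reals, derivable_pt_lim_const.
  - apply (is_derive_plus (fun h => sum1 _ N) _ h _ _ IH).
    generalize (ln (INR (S N))) (ind (smooth p (S N))); intros l i.
    auto_derive; [exact I|unfold Rminus; ring].
Qed.

(** Expanding ln b over its prime factors reduces the left side to the sums of [smooth_sum_logn].
    For q <= p one has q^h <= exp k, so these carry the weights ln q / q, and [mertens_upper] sums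
    them to 2 ln p. The left side is the derivative in h of [smooth_sum p N h], so this is a linear
    differential inequality. *)
Lemma smooth_sum_derive_le (p N : nat) (h k : R) : (1 <= p)%nat ->
  0 <= h <= / 4 -> h * ln (INR p) <= k ->
  sum1 (fun b => ind (smooth p b) * exp ((h - 1) * ln (INR b)) * ln (INR b)) N
  <= 8 * exp k * ln (INR p) * smooth_sum p N h.
Proof.
  intros hp hh hk.
  apply Rle_trans with (sum1 (fun b => sum1 (fun q => (ind (is_prime q) * ln (INR q)) *
    (ind (smooth p b) * exp ((h - 1) * ln (INR b)) * INR (prime.logn q b))) p) N).
  { apply sum1_le; intros b hb.
    destruct (excluded_middle_informative (smooth p b)) as [hs|hs].
    - rewrite (ln_sum_logn b p ltac:(lia) hs) at 2.
      rewrite <- sum1_scal; apply Req_le, sum1_ext; intros; ring.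
    - rewrite ind_false by assumption; rewrite !Rmult_0_l.
      apply sum1_nonneg; intros; lra. }
  rewrite sum1_switch.
  assert (hF := smooth_sum_nonneg p N h).
  assert (he := exp_pos k).
  apply Rle_trans with (sum1 (fun q => (4 * exp k * smooth_sum p N h) *
    (ind (is_prime q) * (ln (INR q) / INR q))) p).
  - apply sum1_le; intros q hq; rewrite sum1_scal.
    destruct (excluded_middle_informative (is_prime q)) as [h1|h1].
    + rewrite ind_true by assumption.
      assert (h2 := smooth_sum_logn p N q h h1 ltac:(lra)).
      assert (h3 := ln_INR_nonneg q). assert (h4 := INR_ge_1 q ltac:(lia)).
      assert (h5 : exp ((h - 1) * ln (INR q)) <= exp k * / INR q).
      { replace ((h - 1) * ln (INR q)) with (h * ln (INR q) + - ln (INR q)) by ring.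
        rewrite exp_plus, exp_Ropp, exp_ln by lra.
        apply Rmult_le_compat_r; [apply Rlt_le, Rinv_0_lt_compat; lra|].
        apply exp_le_compat.
        assert (ln (INR q) <= ln (INR p)) by (apply ln_le; [lra|apply le_INR; lia]). nra. }
      set (S := sum1 _ N) in *.
      apply Rle_trans with (1 * ln (INR q) * (4 * (exp k * / INR q) * smooth_sum p N h)).
      * apply Rmult_le_compat_l; [lra|]. eapply Rle_trans; [exact h2|].
        apply Rmult_le_compat_r; [exact hF|]. lra.
      * right; unfold Rdiv; ring.
    + rewrite ind_false by assumption; lra.
  - rewrite sum1_scal. assert (h1 := mertens_upper p hp).
    assert (0 <= 4 * exp k * smooth_sum p N h) by (apply Rmult_le_pos; lra).
    set (S := sum1 _ p) in *. nra.
Qed.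

(** Gronwall's argument takes the place of an Euler product: F' <= K F on [0, h] gives F(h) <= F(0)
    exp (K h), where F(0) is at most the harmonic sum and K h <= 8 exp k k because h ln p <= k. *)
Lemma smooth_sum_bound (p N : nat) (h k : R) : (1 <= p)%nat -> (1 <= N)%nat ->
  0 <= h <= / 4 -> h * ln (INR p) <= k ->
  smooth_sum p N h <= exp (8 * exp k * k) * (1 + ln (INR N)).
Proof.
  intros hp hN hh hk.
  set (K := 8 * exp k * ln (INR p)).
  assert (hlp := ln_INR_nonneg p).
  assert (h0 : smooth_sum p N 0 <= 1 + ln (INR N)).
  { eapply Rle_trans; [|apply sum1_inv_le, hN].
    apply sum1_le; intros b hb. assert (h1 := INR_ge_1 b ltac:(lia)).
    replace ((0 - 1) * ln (INR b)) with (- ln (INR b)) by ring.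
    rewrite exp_Ropp, exp_ln by lra.
    assert (h2 := ind_bounds (smooth p b)).
    assert (0 < / INR b) by (apply Rinv_0_lt_compat; lra). nra. }
  assert (h1 : smooth_sum p N h * exp (- (K * h)) <= smooth_sum p N 0 * exp (- (K * 0))).
  { set (F' := fun s => sum1 (fun b => ind (smooth p b) *
      exp ((s - 1) * ln (INR b)) * ln (INR b)) N).
    destruct (MVT_gen (fun s => smooth_sum p N s * exp (- (K * s))) 0 h
      (fun s => (F' s - K * smooth_sum p N s) * exp (- (K * s)))) as (s & hs & e).
    - intros s hs.
      assert (hd := is_derive_smooth_sum p N s). fold (F' s) in hd.
      replace ((F' s - K * smooth_sum p N s) * exp (- (K * s))) with
        (F' s * exp (- (K * s)) + smooth_sum p N s * (- K * exp (- (K * s)))) by ring.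
      apply (is_derive_mult (smooth_sum p N) (fun s => exp (- (K * s)))).
      + exact hd.
      + auto_derive; [exact I|ring].
      + intros; apply Rmult_comm.
    - intros s hs.
      apply continuity_pt_filterlim, (continuous_mult (smooth_sum p N)
        (fun s => exp (- (K * s)))).
      + apply (ex_derive_continuous (smooth_sum p N)); eexists; apply is_derive_smooth_sum.
      + apply (ex_derive_continuous (fun s => exp (- (K * s)))); auto_derive; exact I.
    - rewrite Rmin_left, Rmax_right in hs by lra.
      assert (h2 : F' s <= K * smooth_sum p N s).
      { apply smooth_sum_derive_le; [exact hp|lra|]. nra. }
      assert (h3 := exp_pos (- (K * s))).
      assert ((F' s - K * smooth_sum p N s) * exp (- (K * s)) <= 0) by nra.
      nra. }
  rewrite Rmult_0_r, Ropp_0, exp_0, Rmult_1_r, exp_Ropp in h1.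
  assert (hE := exp_pos (K * h)).
  assert (h2 : smooth_sum p N h <= smooth_sum p N 0 * exp (K * h)).
  { apply (Rmult_le_compat_r (exp (K * h))) in h1; [|lra].
    rewrite Rmult_assoc, Rinv_l, Rmult_1_r in h1 by lra. exact h1. }
  assert (h3 : exp (K * h) <= exp (8 * exp k * k)).
  { apply exp_le_compat; unfold K. assert (h4 := exp_pos k). nra. }
  assert (h4 := smooth_sum_nonneg p N 0). assert (h5 := exp_pos (8 * exp k * k)). nra.
Qed.

(** Writing [ndiv b] as the number of factorizations b = i j and dropping the condition i j <= N
    separates the two variables, as f is submultiplicative. *)
Lemma ndiv_weighted_sum (f : nat -> R) (N : nat) :
  (forall n, 0 <= f n) ->
  (forall i j, (1 <= i)%nat -> (1 <= j)%nat -> f (i * j)%nat <= f i * f j) ->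
  sum1 (fun b => INR (ndiv b) * f b) N <= (sum1 f N) ^ 2.
Proof.
  intros hf hm.
  apply Rle_trans with (sum1 (fun b => sum1 (fun i => ind (Nat.divide i b) * f b) N) N).
  - apply sum1_le; intros b hb.
    rewrite (sum1_ext _ (fun i => f b * ind (Nat.divide i b))) by (intros; ring).
    rewrite sum1_scal, Rmult_comm; apply Rmult_le_compat_l; [apply hf|].
    apply ndiv_le_sum; lia.
  - rewrite sum1_switch.
    replace (sum1 f N ^ 2) with (sum1 f N * sum1 f N) by ring.
    rewrite <- sum1_scal; apply sum1_le; intros i hi.
    eapply Rle_trans; [apply sum1_multiples, hf|].
    rewrite Rmult_comm, <- sum1_scal; apply sum1_le; intros j hj; apply hm; lia.
Qed.

(** * Pointwise bounds for the divisor function *)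

Lemma ndiv_1 : INR (ndiv 1) = 1.
Proof. reflexivity. Qed.

Lemma prime_pow_divisor (p a k : nat) : is_prime p -> (1 <= k)%nat -> Nat.divide k (p ^ a) ->
  exists i, (i <= a)%nat /\ k = (p ^ i)%nat.
Proof.
  intros hp; revert k; induction a as [|a IH]; intros k hk hd.
  - exists 0%nat; split; [lia|]. apply Nat.divide_1_r in hd; exact hd.
  - assert (hp2 := prime_ge_2 p hp). simpl in hd.
    destruct (divide_mul_split k p (p ^ a) ltac:(lia) hk hd) as (i & j & hi & hj & e).
    destruct (IH j ltac:(destruct j; nia) hj) as (m & hm & ej).
    destruct (prime_divisor p i hp hi) as [ei|ei]; subst i.
    + exists m; split; [lia|nia].
    + exists (S m); split; [lia|simpl; nia].
Qed.

Lemma ndiv_prime_pow (p a : nat) : is_prime p -> INR (ndiv (p ^ a)) <= INR a + 1.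
Proof.
  intros hp; rewrite ndiv_sum.
  apply Rle_trans with
    (sum1 (fun k => sum1 (fun i => ind ((p ^ (i - 1))%nat = k)) (S a)) (p ^ a)).
  - apply sum1_le; intros k hk.
    destruct (excluded_middle_informative (Nat.divide k (p ^ a))) as [h|h].
    + destruct (prime_pow_divisor p a k hp ltac:(lia) h) as (i & hi & e).
      rewrite ind_true by assumption.
      eapply Rle_trans; [|apply (sum1_term (fun i => ind ((p ^ (i - 1))%nat = k)) (S i))];
        [|intros; apply ind_bounds|lia]; cbv beta.
      rewrite ind_true; [lra|]. rewrite e; f_equal; lia.
    + rewrite ind_false by assumption; apply sum1_nonneg; intros; apply ind_bounds.
  - rewrite sum1_switch, <- S_INR.
    apply Rle_trans with (sum1 (fun _ => 1) (S a)).
    + apply sum1_le; intros; apply sum1_ind_eq_le.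
    + generalize (S a); intros n; induction n as [|n IH]; [simpl; lra|].
      rewrite S_INR; simpl sum1; lra.
Qed.

(** Each prime factor at most doubles the number of divisors, and n has at most ln n / ln p prime
    factors, counted with multiplicity, when all are at least p. *)
Lemma ndiv_rough_bound (p n : nat) : (2 <= p)%nat -> (1 <= n)%nat ->
  (forall r, is_prime r -> Nat.divide r n -> (p <= r)%nat) ->
  INR (ndiv n) <= exp (ln 2 / ln (INR p) * ln (INR n)).
Proof.
  intros hp.
  assert (hl : ln 2 <= ln (INR p)) by
      (apply ln_le; [lra|]; replace 2 with (INR 2) by reflexivity; now apply le_INR).
  assert (l2 := ln_lt_2).
  induction n as [n IH] using (well_founded_induction Wf_nat.lt_wf); intros hn hr.
  destruct (Nat.eq_dec n 1) as [e|e].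
  - subst n; rewrite ndiv_1; simpl INR; rewrite ln_1, Rmult_0_r, exp_0; lra.
  - destruct (least_prime n ltac:(lia)) as (r & h1 & h2 & _).
    assert (h3 := hr r h1 h2). destruct h2 as [m hm].
    assert (hm1 : (1 <= m)%nat) by (destruct m; lia).
    assert (h4 : INR (ndiv m) <= exp (ln 2 / ln (INR p) * ln (INR m))).
    { apply IH; [nia|lia|]. intros s hs [c hc]; apply hr; [exact hs|exists (c * r)%nat; nia]. }
    replace n with (r * m)%nat by lia.
    rewrite exp_ln_mul by lia.
    eapply Rle_trans; [apply ndiv_mul_le; lia|].
    apply Rmult_le_compat; try apply ndiv_nonneg; [|exact h4].
    rewrite <- (Nat.pow_1_r r) at 1.
    eapply Rle_trans; [apply ndiv_prime_pow, h1|]. simpl INR.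
    replace (1 + 1) with (exp (ln 2)) by (rewrite exp_ln; lra).
    apply exp_le_compat.
    assert (ln (INR p) <= ln (INR r)) by (apply ln_le; [apply lt_0_INR; lia|now apply le_INR]).
    apply (Rmult_le_reg_r (ln (INR p))); [lra|].
    replace (ln 2 / ln (INR p) * ln (INR r) * ln (INR p)) with (ln 2 * ln (INR r))
      by (field; lra). nra.
Qed.

Lemma extract_power (p n : nat) : (2 <= p)%nat -> (1 <= n)%nat ->
  exists a m, n = (p ^ a * m)%nat /\ (1 <= m)%nat /\ ~ Nat.divide p m.
Proof.
  intros hp; induction n as [n IH] using (well_founded_induction Wf_nat.lt_wf); intros hn.
  destruct (excluded_middle_informative (Nat.divide p n)) as [[k hk]|h].
  - destruct (IH k ltac:(nia) ltac:(nia)) as (a & m & e & hm & hd).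
    exists (S a), m; repeat split; [simpl; nia|exact hm|exact hd].
  - exists 0%nat, n; repeat split; [simpl; lia|exact hn|exact h].
Qed.

(** Primes from a threshold P on, where ln 2 / ln P <= e, are covered by [ndiv_rough_bound]. The
    finitely many smaller primes are stripped off one at a time by induction on k, each multiplying
    the constant by a fixed K. *)
Lemma ndiv_bound (e : R) : 0 < e -> exists C, 1 <= C /\
  forall n, (1 <= n)%nat -> INR (ndiv n) <= C * exp (e * ln (INR n)).
Proof.
  intros he.
  destruct (nfloor_ex (exp (ln 2 / e)) ltac:(apply Rlt_le, exp_pos)) as [P0 hP0].
  assert (l2 := ln_lt_2).
  set (P := S (S P0)).
  assert (hP : ln 2 / ln (INR P) <= e).
  { assert (h1 : ln 2 / e < ln (INR P)).
    { rewrite <- (ln_exp (ln 2 / e)); apply ln_increasing; [apply exp_pos|].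
      unfold P; rewrite S_INR, S_INR; lra. }
    assert (h0 : 0 < ln 2 / e) by (apply Rdiv_lt_0_compat; lra).
    apply Rle_div_l; [lra|]. apply Rlt_div_l in h1; lra. }
  assert (h : forall k, exists C, 1 <= C /\ forall n, (1 <= n)%nat ->
    (forall r, is_prime r -> Nat.divide r n -> (P <= r + k)%nat) ->
    INR (ndiv n) <= C * exp (e * ln (INR n))).
  { induction k as [|k (C & hC & IH)].
    - exists 1; split; [lra|]; intros n hn hr; rewrite Rmult_1_l.
      eapply Rle_trans; [apply (ndiv_rough_bound P n); [unfold P; lia|exact hn|]|].
      + intros r h1 h2; specialize (hr r h1 h2); lia.
      + apply exp_le_compat, Rmult_le_compat_r; [apply ln_INR_nonneg|exact hP].
    (* Chosen so that a + 1 <= K (1 + a e ln 2) for all a >= 0; the bracket is at most 2^(a e),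
       hence at most N^(a e). *)
    - set (K := 1 + / (e * ln 2)).
      assert (hel : 0 < e * ln 2) by (apply Rmult_lt_0_compat; lra).
      assert (hK : 1 <= K) by (unfold K; assert (0 < / (e * ln 2)) by
        (apply Rinv_0_lt_compat; lra); lra).
      exists (K * C); split; [nra|]; intros n hn hr.
      set (N := (P - S k)%nat).
      destruct (excluded_middle_informative (is_prime N)) as [hN|hN].
      + assert (hN2 := prime_ge_2 N hN).
        destruct (extract_power N n hN2 hn) as (a & m & en & hm & hd).
        assert (ha : (1 <= N ^ a)%nat).
        { assert (N ^ a <> 0)%nat by (apply Nat.pow_nonzero; lia). lia. }
        assert (h1 : INR (ndiv m) <= C * exp (e * ln (INR m))).
        { apply IH; [exact hm|]. intros r h1 h2.
          assert (h3 : (P <= r + S k)%nat).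
          { apply hr; [exact h1|]. destruct h2 as [c hc]; exists (N ^ a * c)%nat; nia. }
          assert (r <> N) by (intros e1; subst r; tauto). lia. }
        rewrite en; rewrite exp_ln_mul by lia.
        eapply Rle_trans; [apply ndiv_mul_le; lia|].
        apply Rle_trans with ((K * exp (e * ln (INR (N ^ a)))) * (C * exp (e * ln (INR m))));
          [|right; ring].
        apply Rmult_le_compat; try apply ndiv_nonneg; [|exact h1].
        eapply Rle_trans; [apply ndiv_prime_pow, hN|].
        rewrite pow_INR, ln_pow by (apply lt_0_INR; lia).
        apply Rle_trans with (K * (1 + INR a * (e * ln 2))).
        * unfold K. assert (h2 := pos_INR a).
          replace ((1 + / (e * ln 2)) * (1 + INR a * (e * ln 2))) with
            (1 + INR a * (e * ln 2) + / (e * ln 2) + INR a) by (field; lra).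
          assert (0 < / (e * ln 2)) by (apply Rinv_0_lt_compat; lra). nra.
        * apply Rmult_le_compat_l; [lra|].
          eapply Rle_trans; [apply exp_ineq1_le|]. apply exp_le_compat.
          assert (hl : ln 2 <= ln (INR N)) by
           (apply ln_le; [lra|]; replace 2 with (INR 2) by reflexivity; now apply le_INR).
          assert (h2 := pos_INR a).
          replace (e * (INR a * ln (INR N))) with (INR a * (e * ln (INR N))) by ring.
          apply Rmult_le_compat_l; [exact h2|]. apply Rmult_le_compat_l; lra.
      + assert (h1 : INR (ndiv n) <= C * exp (e * ln (INR n))).
        { apply IH; [exact hn|]; intros r h1 h2. assert (h3 := hr r h1 h2).
          assert (h4 := prime_ge_2 r h1).
          assert (r <> N) by (intros e1; subst r; tauto). lia. }
        assert (h2 := exp_pos (e * ln (INR n))).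
        assert (0 <= (K - 1) * C * exp (e * ln (INR n))) by
          (repeat apply Rmult_le_pos; lra). nra. }
  (* With k = P the condition on the prime factors always holds. *)
  destruct (h P) as (C & hC & hb); exists C; split; [exact hC|].
  intros n hn; apply hb; [exact hn|intros; lia].
Qed.

(** Strong induction on the cofactor q, with the invariant that no prime of b exceeds a prime of q;
    moving the least prime p of q into b preserves it. When the move would pass z, the invariant
    makes b p-smooth and minimality keeps the primes of q at or above p. *)
Lemma greedy_factorization (z : R) (n : nat) : 1 <= z -> (1 <= n)%nat ->
  exists b q, n = (b * q)%nat /\ (1 <= b)%nat /\ (1 <= q)%nat /\ INR b <= z /\
    (q = 1%nat \/ exists p, is_prime p /\ Nat.divide p q /\ smooth p b /\
      (forall r, is_prime r -> Nat.divide r q -> (p <= r)%nat) /\ z < INR (b * p)).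
Proof.
  intros hz hn.
  assert (h : forall q b, (1 <= q)%nat -> (1 <= b)%nat -> n = (b * q)%nat -> INR b <= z ->
    (forall r s, is_prime r -> is_prime s -> Nat.divide r b -> Nat.divide s q -> (r <= s)%nat) ->
    exists b q, n = (b * q)%nat /\ (1 <= b)%nat /\ (1 <= q)%nat /\ INR b <= z /\
    (q = 1%nat \/ exists p, is_prime p /\ Nat.divide p q /\ smooth p b /\
      (forall r, is_prime r -> Nat.divide r q -> (p <= r)%nat) /\ z < INR (b * p))).
  { induction q as [q IH] using (well_founded_induction Wf_nat.lt_wf).
    intros b hq hb e hbz hrs.
    destruct (Nat.eq_dec q 1) as [e1|e1]; [exists b, q; tauto|].
    destruct (least_prime q ltac:(lia)) as (p & hp & hpq & hmin).
    assert (hp2 := prime_ge_2 p hp).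
    destruct (Rlt_le_dec z (INR (b * p))) as [h1|h1].
    - exists b, q; repeat split; try assumption; right; exists p; repeat split; try assumption.
      intros r hr hd; exact (hrs r p hr hp hd hpq).
    - destruct hpq as [q' hq'].
      apply (IH q' ltac:(nia) (b * p)%nat); [nia|nia|nia|exact h1|].
      intros r s hr hs hdr hds.
      assert (hsq : Nat.divide s q) by (destruct hds as [c hc]; exists (c * p)%nat; nia).
      destruct (prime_euclid r b p hr hdr) as [h2|h2].
      + now apply (hrs r s).
      + destruct (prime_divisor p r hp h2) as [h3|h3]; subst r.
        * discriminate hr.
        * now apply hmin. }
  apply (h n 1%nat); [exact hn|lia|lia|exact hz|].
  intros r s hr hs hd _; apply Nat.divide_1_r in hd; subst r; discriminate hr.
Qed.

(** * Divisor sums over short intervals *)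

(** The value k / ln p makes p^h equal to exp k, and the cap 1/4 is the range in which
    [smooth_sum_logn] works. *)
Definition rankin_exponent (k : R) (p : nat) : R := Rmin (/ 4) (k / ln (INR p)).

(** Summing over all b and p instead of the greedy pair leaves only divisibility conditions on n,
    whose sums over an interval are counts of multiples. The weight ln p / L is the surplus of
    Rankin's gain, which later completes the Mertens sum. *)
Definition greedy_majorant (k L : R) (Z n : nat) : R :=
  sum1 (fun b => INR (ndiv b) * ind (Nat.divide b n)) Z +
  sum1 (fun p => ind (is_prime p) * (ln (INR p) / L) *
    sum1 (fun b => ind (2 * ln (INR p) <= L) * (INR (ndiv b) *
      (ind (smooth p b) * exp (rankin_exponent k p * ln (INR b)))) *
      ind (Nat.divide (b * p) n)) Z) Z.

Lemma ln_prime_ge (p : nat) : (2 <= p)%nat -> / 2 < ln (INR p).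
Proof.
  intros hp. assert (l2 := ln_lt_2).
  assert (ln 2 <= ln (INR p)) by
    (apply ln_le; [lra|]; replace 2 with (INR 2) by reflexivity; now apply le_INR). lra.
Qed.

(* Either the least prime [p] of the cofactor [q] exceeds [sqrt z], and [ndiv q] is bounded,
   or [b > sqrt z] and Rankin's factor [b^(rankin_exponent p)] absorbs [ndiv q]. *)
Lemma ndiv_greedy_bound (a : R) : 1 <= a -> exists C k, 0 < C /\ 0 < k /\
  forall (z : R) (Z n : nat), 1 < z -> (forall b : nat, INR b <= z -> (b <= Z)%nat) ->
  (1 <= n)%nat -> ln (INR n) <= a * ln z ->
  INR (ndiv n) <= C * greedy_majorant k (ln z) Z n.
Proof.
  intros ha.
  (* As ln q <= a L, this exponent gives [ndiv q] <= C0 exp (L / 16). *)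
  destruct (ndiv_bound (/ (16 * a)) ltac:(apply Rinv_0_lt_compat; lra)) as (C0 & hC0 & hd0).
  assert (l2 := ln_lt_2).
  assert (l21 : ln 2 <= 1) by (assert (h := ln_le_sub_1 2 ltac:(lra)); lra).
  (* With v = L / ln p and b >= exp (L / 2), Rankin's factor at exponent k / ln p is at least exp
     ((a + 1) v): the part exp (a v) pays for [ndiv q], and exp v >= v pays for the weight ln p / L
     = 1 / v. *)
  set (k := 2 * (a + 1)).
  assert (hA := exp_pos (2 * a)).
  (* The three summands serve p > sqrt z, p <= sqrt z and q = 1. *)
  exists (exp (2 * a) + 32 * C0 + 1), k; repeat split; [lra|unfold k; lra|].
  intros z Z n hz hZ hn hln.
  set (L := ln z) in *.
  assert (hL : 0 < L) by (unfold L; rewrite <- ln_1; apply ln_increasing; lra).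
  destruct (greedy_factorization z n ltac:(lra) hn) as (b & q & en & hb & hq & hbz & hcase).
  assert (hbZ := hZ b hbz).
  set (S1 := sum1 (fun b => INR (ndiv b) * ind (Nat.divide b n)) Z).
  assert (hS1 : INR (ndiv b) <= S1).
  { unfold S1. eapply Rle_trans;
      [|apply (sum1_term (fun b => INR (ndiv b) * ind (Nat.divide b n)) b)]; cbv beta.
    - rewrite ind_true; [lra|]. exists q; lia.
    - intros; apply Rmult_le_pos; [apply ndiv_nonneg|apply ind_bounds].
    - lia. }
  set (g := fun p b => ind (2 * ln (INR p) <= L) * (INR (ndiv b) *
      (ind (smooth p b) * exp (rankin_exponent k p * ln (INR b)))) *
      ind (Nat.divide (b * p) n)).
  assert (hg : forall p b, 0 <= g p b).
  { intros; unfold g; repeat apply Rmult_le_pos; try apply ind_bounds;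
      [apply ndiv_nonneg|apply Rlt_le, exp_pos]. }
  set (S2 := sum1 (fun p => ind (is_prime p) * (ln (INR p) / L) *
    sum1 (fun b => g p b) Z) Z).
  assert (hterm : forall p, 0 <= ind (is_prime p) * (ln (INR p) / L) * sum1 (fun b => g p b) Z).
  { intros p; repeat apply Rmult_le_pos; [apply ind_bounds|apply ln_INR_nonneg| |].
    - apply Rlt_le, Rinv_0_lt_compat, hL.
    - apply sum1_nonneg; intros; apply hg. }
  assert (hS2 : 0 <= S2) by (apply sum1_nonneg; intros; apply hterm).
  assert (hb0 := ndiv_nonneg b).
  change (greedy_majorant k L Z n) with (S1 + S2).
  assert (hdn : INR (ndiv n) <= INR (ndiv b) * INR (ndiv q)) by
    (rewrite en; apply ndiv_mul_le; assumption).
  destruct hcase as [e|(p & hp & hpq & hsm & hmin & hbp)].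
  { subst q; rewrite ndiv_1 in hdn. nra. }
  assert (hp2 := prime_ge_2 p hp). assert (hlp := ln_prime_ge p hp2).
  assert (hb1 := INR_ge_1 b hb). assert (hlb := ln_INR_nonneg b).
  assert (hlq : ln (INR q) <= a * L).
  { eapply Rle_trans; [|exact hln]. apply ln_le; [apply lt_0_INR; lia|].
    apply le_INR; nia. }
  assert (hdq := ndiv_rough_bound p q hp2 hq hmin).
  assert (hbp' : L < ln (INR b) + ln (INR p)).
  { unfold L; rewrite <- ln_mult by (apply lt_0_INR; lia).
    rewrite <- mult_INR; apply ln_increasing; lra. }
  set (v := L / ln (INR p)).
  assert (hv : L = v * ln (INR p)) by (unfold v; field; lra).
  assert (hv0 : 0 < v) by (unfold v; apply Rdiv_lt_0_compat; lra).
  assert (hdq' : INR (ndiv q) <= exp (a * v)).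
  { eapply Rle_trans; [exact hdq|]. apply exp_le_compat.
    replace (a * v) with (/ ln (INR p) * (a * L)) by (unfold v; field; lra).
    unfold Rdiv. rewrite (Rmult_comm (ln 2)), Rmult_assoc.
    apply Rmult_le_compat_l; [apply Rlt_le, Rinv_0_lt_compat; lra|].
    assert (h := ln_INR_nonneg q). nra. }
  destruct (Rlt_le_dec L (2 * ln (INR p))) as [hlarge|hsmall].
  - assert (v <= 2) by (unfold v; apply Rle_div_l; lra).
    assert (INR (ndiv q) <= exp (2 * a)).
    { eapply Rle_trans; [exact hdq'|]. apply exp_le_compat; nra. }
    apply Rle_trans with (exp (2 * a) * S1); [|nra].
    eapply Rle_trans; [exact hdn|]. rewrite Rmult_comm.
    apply Rmult_le_compat; try apply ndiv_nonneg; assumption.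
  - assert (hpZ : (p <= Z)%nat).
    { apply hZ. apply Rnot_lt_le; intros h; apply ln_increasing in h; [|lra]. fold L in h; lra. }
    assert (h1 : ln (INR p) / L * (INR (ndiv b) * exp (rankin_exponent k p * ln (INR b))) <= S2).
    { unfold S2. eapply Rle_trans; [|apply (sum1_term (fun p => ind (is_prime p) * (ln (INR p) / L) *
        sum1 (fun b => g p b) Z) p Z hterm); lia]; cbv beta.
      rewrite (ind_true (is_prime p)) by assumption. rewrite Rmult_1_l.
      apply Rmult_le_compat_l; [apply Rlt_le, Rdiv_lt_0_compat; lra|].
      eapply Rle_trans; [|apply (sum1_term (fun b => g p b) b)];
        [|intros; apply hg|lia].
      unfold g. rewrite !ind_true; [lra| |exact hsm|exact hsmall].
      rewrite en. destruct hpq as [c hc]; exists c; nia. }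
    assert (hkey : INR (ndiv q) <= 32 * C0 *
      (ln (INR p) / L * exp (rankin_exponent k p * ln (INR b)))).
    { replace (ln (INR p) / L) with (/ v) by (unfold v; field; lra).
      (* Because b p > z and p^2 <= z. *)
      assert (hlbL : L / 2 <= ln (INR b)) by lra.
      unfold rankin_exponent, Rmin; destruct (Rle_dec (/ 4) (k / ln (INR p))) as [hr|hr].
      (* Where the cap is active, b^(1/4) >= exp (L / 8) splits into two factors exp (L / 16), one
         for [ndiv q] and one for v <= 2 L. *)
      - assert (h2 : INR (ndiv q) <= C0 * exp (L / 16)).
        { eapply Rle_trans; [apply hd0, hq|]. apply Rmult_le_compat_l; [lra|].
          apply exp_le_compat. replace (L / 16) with (/ (16 * a) * (a * L)) by (field; lra).
          apply Rmult_le_compat_l; [apply Rlt_le, Rinv_0_lt_compat; lra|exact hlq]. }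
        assert (h3 : v <= 32 * exp (L / 16)).
        { assert (h4 := exp_ineq1_le (L / 16)).
          assert (v <= 2 * L) by (unfold v; apply Rle_div_l; nra). lra. }
        assert (h4 : exp (L / 16) * exp (L / 16) <= exp (/ 4 * ln (INR b))).
        { rewrite <- exp_plus; apply exp_le_compat; lra. }
        assert (h5 := exp_pos (L / 16)).
        eapply Rle_trans; [exact h2|].
        apply (Rmult_le_reg_r v); [exact hv0|].
        replace (32 * C0 * (/ v * exp (/ 4 * ln (INR b))) * v) with
          (C0 * (32 * exp (/ 4 * ln (INR b)))) by (field; lra).
        rewrite Rmult_assoc; apply Rmult_le_compat_l; [lra|]. nra.
      - assert (h2 : exp (a * v) * v <= exp (k / ln (INR p) * ln (INR b))).
        { apply Rle_trans with (exp (a * v) * exp v).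
          - apply Rmult_le_compat_l; [apply Rlt_le, exp_pos|].
            assert (h := exp_ineq1_le v); lra.
          - rewrite <- exp_plus; apply exp_le_compat.
            apply Rle_trans with (k / ln (INR p) * (L / 2)).
            + unfold k; rewrite hv; right; field; lra.
            + apply Rmult_le_compat_l; [|exact hlbL].
              apply Rlt_le, Rdiv_lt_0_compat; [unfold k; lra|lra]. }
        eapply Rle_trans; [exact hdq'|].
        apply (Rmult_le_reg_r v); [exact hv0|].
        replace (32 * C0 * (/ v * exp (k / ln (INR p) * ln (INR b))) * v) with
          (32 * C0 * exp (k / ln (INR p) * ln (INR b))) by (field; lra).
        assert (h3 := exp_pos (k / ln (INR p) * ln (INR b))). nra. }
    assert (hS1' : 0 <= S1) by lra.
    apply Rle_trans with (32 * C0 * S2); [|nra].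
    eapply Rle_trans; [exact hdn|].
    apply Rle_trans with (INR (ndiv b) * (32 * C0 *
      (ln (INR p) / L * exp (rankin_exponent k p * ln (INR b))))).
    + apply Rmult_le_compat_l; assumption.
    + apply Rle_trans with (32 * C0 * (ln (INR p) / L *
        (INR (ndiv b) * exp (rankin_exponent k p * ln (INR b))))); [right; ring|].
      apply Rmult_le_compat_l; [lra|exact h1].
Qed.

Lemma sum1_ndiv_over (N : nat) : (1 <= N)%nat ->
  sum1 (fun b => INR (ndiv b) * / INR b) N <= (1 + ln (INR N)) ^ 2.
Proof.
  intros hN. eapply Rle_trans; [apply ndiv_weighted_sum|].
  - intros [|n]; [simpl; rewrite Rinv_0; lra|].
    apply Rlt_le, Rinv_0_lt_compat, lt_0_INR; lia.
  - intros i j hi hj; rewrite mult_INR, Rinv_mult; lra.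
  - apply pow_incr; split; [|apply sum1_inv_le, hN].
    apply sum1_nonneg; intros; apply Rlt_le, Rinv_0_lt_compat, lt_0_INR; lia.
Qed.

Lemma sum1_ndiv_smooth (p N : nat) (h k : R) : (1 <= p)%nat -> (1 <= N)%nat ->
  0 <= h <= / 4 -> h * ln (INR p) <= k ->
  sum1 (fun b => INR (ndiv b) * (ind (smooth p b) * exp ((h - 1) * ln (INR b)))) N
  <= (exp (8 * exp k * k) * (1 + ln (INR N))) ^ 2.
Proof.
  intros hp hN hh hk.
  eapply Rle_trans; [apply ndiv_weighted_sum|].
  - intros; apply Rmult_le_pos; [apply ind_bounds|apply Rlt_le, exp_pos].
  - intros i j hi hj; rewrite exp_ln_mul by assumption.
    destruct (excluded_middle_informative (smooth p (i * j))) as [h1|h1].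
    + rewrite !ind_true; [lra|now apply (smooth_mul_r p i)|
        now apply (smooth_mul_l p i j)|exact h1].
    + rewrite (ind_false _ h1), Rmult_0_l.
      repeat apply Rmult_le_pos; try apply ind_bounds; apply Rlt_le, exp_pos.
  - apply pow_incr; split; [apply smooth_sum_nonneg|now apply smooth_sum_bound].
Qed.

(** With z = x^(d/2), every modulus b or b p that occurs is at most z^2 <= y, so at most 2 y / e of
    the integers counted are multiples of a modulus e. The weighted sums over b are then O (ln^2 x).
    The bound y is separate from the length M, so that intervals shorter than x^d are covered
    too. *)
Lemma ndiv_short_interval (d : R) : 0 < d <= 2 -> exists C, 0 < C /\
  forall (N M : nat) (x y : R), exp 1 <= x -> INR (N + M) <= x -> INR M <= y ->
  exp (d * ln x) <= y ->
  sum1 (fun j => INR (ndiv (N + j))) M <= C * y * (ln x) ^ 2.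
Proof.
  intros hd.
  destruct (ndiv_greedy_bound (2 / d)) as (C & k & hC & hk & hmaj).
  (* The parameter 2 / d is ln x / ln z, which bounds ln n / ln z for n <= x. *)
  { apply Rle_div_r; lra. }
  set (W := exp (8 * exp k * k)).
  assert (hW : 0 < W) by apply exp_pos.
  exists (C * (8 + 16 * W ^ 2)); split; [apply Rmult_lt_0_compat; nra|].
  intros N M x y hx hNM hM hy.
  assert (hx0 : 0 < x) by (assert (h := exp_pos 1); lra).
  assert (hlx : 1 <= ln x) by
    (rewrite <- (ln_exp 1); apply ln_le; [apply exp_pos|exact hx]).
  set (L := d / 2 * ln x). set (z := exp L).
  assert (hL : 0 < L) by (unfold L; apply Rmult_lt_0_compat; lra).
  assert (hLx : L <= ln x) by (unfold L; nra).
  assert (hz : 1 < z) by (unfold z; rewrite <- exp_0; apply exp_increasing; lra).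
  assert (hlz : ln z = L) by apply ln_exp.
  destruct (nfloor_ex z ltac:(lra)) as [Z hZ].
  assert (hZ1 : (1 <= Z)%nat).
  { destruct Z; [simpl in hZ; lra|lia]. }
  assert (hlZ : ln (INR Z) <= L).
  { rewrite <- hlz; apply ln_le; [apply lt_0_INR; lia|lra]. }
  assert (hZb : forall b : nat, INR b <= z -> (b <= Z)%nat).
  { intros b hb. assert (h : INR b < INR (S Z)) by (rewrite S_INR; lra).
    apply INR_lt in h; lia. }
  assert (hy2 : z * z <= y).
  { eapply Rle_trans; [|exact hy]. unfold z; rewrite <- exp_plus.
    apply exp_le_compat; unfold L; lra. }
  assert (hcount : forall e : nat, (1 <= e)%nat -> INR e <= y ->
    sum1 (fun j => ind (Nat.divide e (N + j))) M <= 2 * y * / INR e).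
  { intros e he hey. eapply Rle_trans; [apply count_multiples_interval, he|].
    assert (he1 := INR_ge_1 e he). unfold Rdiv.
    assert (0 < / INR e) by (apply Rinv_0_lt_compat; lra).
    assert (1 <= y * / INR e) by (apply Rle_div_r; lra). nra. }
  assert (hlZ0 := ln_INR_nonneg Z).
  assert (hlog : (1 + ln (INR Z)) ^ 2 <= 4 * ln x ^ 2) by nra.
  apply Rle_trans with (sum1 (fun j => C * greedy_majorant k (ln z) Z (N + j)) M).
  { apply sum1_le; intros j hj; apply hmaj; [exact hz|exact hZb|lia|].
    rewrite hlz. replace (2 / d * L) with (ln x) by (unfold L; field; lra).
    apply ln_le; [apply lt_0_INR; lia|].
    eapply Rle_trans; [|exact hNM]. apply le_INR; lia. }
  rewrite sum1_scal, !Rmult_assoc; apply Rmult_le_compat_l; [lra|].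
  unfold greedy_majorant; rewrite sum1_plus, Rmult_plus_distr_r, hlz.
  apply Rplus_le_compat.
  - rewrite sum1_switch.
    apply Rle_trans with (sum1 (fun b => 2 * y * (INR (ndiv b) * / INR b)) Z).
    + apply sum1_le; intros b hb; rewrite sum1_scal.
      replace (2 * y * (INR (ndiv b) * / INR b)) with
        (INR (ndiv b) * (2 * y * / INR b)) by ring.
      apply Rmult_le_compat_l; [apply ndiv_nonneg|].
      apply hcount; [lia|]. assert (INR b <= INR Z) by (apply le_INR; lia). nra.
    + rewrite sum1_scal. assert (h := sum1_ndiv_over Z hZ1).
      assert (0 <= 2 * y) by nra.
      apply Rle_trans with (2 * y * (4 * ln x ^ 2)); [|lra].
      apply Rmult_le_compat_l; lra.
  - rewrite sum1_switch.
    (* The 1 / p from the modulus b p joins the weight ln p / L to form the Mertens sum, whose bound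
       2 L cancels the division by L. *)
    apply Rle_trans with (sum1 (fun p => (2 * y * (W * (1 + ln (INR Z))) ^ 2 / L) *
      (ind (is_prime p) * (ln (INR p) / INR p))) Z).
    + apply sum1_le; intros p hp; rewrite sum1_scal.
      destruct (excluded_middle_informative (is_prime p)) as [h1|h1];
        [|rewrite ind_false by assumption; lra].
      rewrite ind_true, !Rmult_1_l by assumption.
      assert (hp2 := prime_ge_2 p h1). assert (hlp := ln_prime_ge p hp2).
      assert (hp1 := INR_ge_1 p ltac:(lia)).
      replace (2 * y * (W * (1 + ln (INR Z))) ^ 2 / L * (ln (INR p) / INR p)) with
        (ln (INR p) / L * (2 * y / INR p * (W * (1 + ln (INR Z))) ^ 2)) by (field; lra).
      apply Rmult_le_compat_l; [apply Rlt_le, Rdiv_lt_0_compat; lra|].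
      rewrite sum1_switch.
      assert (hbnd : 0 <= 2 * y / INR p) by (apply Rle_mult_inv_pos; nra).
      set (h := rankin_exponent k p).
      assert (hh : 0 <= h <= / 4).
      { unfold h, rankin_exponent; split; [|apply Rmin_l].
        apply Rmin_glb; [lra|apply Rlt_le, Rdiv_lt_0_compat; lra]. }
      assert (hhk : h * ln (INR p) <= k).
      { apply Rle_div_r; [lra|]. unfold h, rankin_exponent; apply Rmin_r. }
      apply Rle_trans with (sum1 (fun b => 2 * y / INR p *
        (INR (ndiv b) * (ind (smooth p b) * exp ((h - 1) * ln (INR b))))) Z).
      * apply sum1_le; intros b hb; rewrite sum1_scal.
        assert (hb1 := INR_ge_1 b ltac:(lia)).
        assert (h0 : 0 <= INR (ndiv b) * (ind (smooth p b) * exp (h * ln (INR b)))).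
        { repeat apply Rmult_le_pos; [apply ndiv_nonneg|apply ind_bounds|
            apply Rlt_le, exp_pos]. }
        replace (exp ((h - 1) * ln (INR b))) with (exp (h * ln (INR b)) * / INR b).
        2:{ replace ((h - 1) * ln (INR b)) with (h * ln (INR b) + - ln (INR b)) by ring.
            rewrite exp_plus, exp_Ropp, exp_ln by lra; reflexivity. }
        replace (2 * y / INR p * (INR (ndiv b) * (ind (smooth p b) *
          (exp (h * ln (INR b)) * / INR b)))) with
          (INR (ndiv b) * (ind (smooth p b) * exp (h * ln (INR b))) *
           (2 * y * / INR (b * p))) by (rewrite mult_INR; field; lra).
        destruct (excluded_middle_informative (2 * ln (INR p) <= L)) as [h2|h2].
        -- rewrite ind_true, Rmult_1_l by assumption.
           apply Rmult_le_compat_l; [exact h0|]. apply hcount; [nia|].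
           rewrite mult_INR.
           assert (INR b <= z) by (apply Rle_trans with (INR Z); [apply le_INR; lia|lra]).
           assert (INR p <= z) by (apply Rle_trans with (INR Z); [apply le_INR; lia|lra]).
           nra.
        -- rewrite ind_false, !Rmult_0_l by assumption.
           apply Rmult_le_pos; [exact h0|]. apply Rmult_le_pos; [nra|].
           apply Rlt_le, Rinv_0_lt_compat, lt_0_INR; nia.
      * rewrite sum1_scal; apply Rmult_le_compat_l; [exact hbnd|].
        apply sum1_ndiv_smooth; [lia|exact hZ1|exact hh|exact hhk].
    + rewrite sum1_scal.
      assert (hm := mertens_upper Z hZ1).
      apply Rle_trans with (2 * y * (W * (1 + ln (INR Z))) ^ 2 / L * (2 * L)).
      * apply Rmult_le_compat_l; [|lra].
        apply Rle_mult_inv_pos; [|exact hL]. apply Rmult_le_pos; [nra|apply pow2_ge_0].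
      * replace (2 * y * (W * (1 + ln (INR Z))) ^ 2 / L * (2 * L)) with
          (4 * W ^ 2 * y * (1 + ln (INR Z)) ^ 2) by (field; lra).
        apply Rle_trans with (4 * W ^ 2 * y * (4 * ln x ^ 2)); [|right; ring].
        apply Rmult_le_compat_l; [|exact hlog].
        apply Rmult_le_pos; [nra|nra].
Qed.

(** * The zeta function on the critical line *)

(** This is n^(-1/2), kept as an exponential to match [npow_neg] on the critical line. *)
Definition isqrt (n : nat) : R := exp (- / 2 * ln (INR n)).

Lemma isqrt_small (e : R) : 0 < e -> exists N, (1 <= N)%nat /\ isqrt N < e.
Proof.
  intros he.
  destruct (nfloor_ex (/ e * / e) ltac:(apply Rlt_le, Rmult_lt_0_compat;
    apply Rinv_0_lt_compat, he)) as [N hN].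
  exists (S N); split; [lia|].
  unfold isqrt. rewrite <- (exp_ln e he). apply exp_increasing.
  assert (h : ln (/ e * / e) < ln (INR (S N))).
  { apply ln_increasing; [apply Rmult_lt_0_compat; apply Rinv_0_lt_compat, he|].
    rewrite S_INR; lra. }
  rewrite ln_mult, ln_Rinv in h by (try apply Rinv_0_lt_compat; assumption). lra.
Qed.

(* Replacing [a N] by [a N - (-1)^(N-1) f N / 2] makes consecutive differences telescope
   without pairing terms. *)
Lemma alternating_cauchy (a f e : nat -> R) (W : R) : 0 <= W ->
  (forall k, a (S k) = a k + (-1) ^ k * f (S k)) ->
  (forall n, (1 <= n)%nat -> Rabs (f n) <= W * e n) ->
  (forall n, (1 <= n)%nat -> Rabs (f (S n) - f n) <= W * (e n - e (S n))) ->
  forall N M, (1 <= N)%nat -> (N <= M)%nat -> Rabs (a M - a N) <= W * e N.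
Proof.
  intros hW ha hf hdf N M hN hNM.
  set (c := fun n => a n + (-1) ^ n * f n / 2).
  assert (hs : forall n, Rabs ((-1) ^ n) = 1) by apply pow_1_abs.
  assert (hc : Rabs (c M - c N) <= W / 2 * (e N - e M)).
  { induction hNM as [|M hNM IH].
    - rewrite Rminus_diag, Rabs_R0; lra.
    - replace (c (S M) - c N) with ((c M - c N) + (-1) ^ M * ((f (S M) - f M) / 2))
        by (unfold c; rewrite ha; simpl; field).
      eapply Rle_trans; [apply Rabs_triang|].
      rewrite Rabs_mult, hs, Rmult_1_l.
      unfold Rdiv at 1; rewrite Rabs_mult, (Rabs_right (/ 2)) by lra.
      assert (h := hdf M ltac:(lia)). lra. }
  replace (a M - a N) with
    ((c M - c N) + ((-1) ^ N * (f N / 2) + - ((-1) ^ M * (f M / 2))))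
    by (unfold c; field).
  eapply Rle_trans; [apply Rabs_triang|].
  assert (h1 := Rabs_triang ((-1) ^ N * (f N / 2)) (- ((-1) ^ M * (f M / 2)))).
  rewrite Rabs_Ropp, !Rabs_mult, !hs, !Rmult_1_l in h1.
  unfold Rdiv in h1 at 3 4; rewrite !Rabs_mult, !(Rabs_right (/ 2)) in h1 by lra.
  assert (h2 := hf N hN). assert (h3 := hf M ltac:(lia)). lra.
Qed.

Lemma nondecreasing_of_deriv (g g' : R -> R) (a b : R) : a <= b ->
  (forall x, is_derive g x (g' x)) -> (forall x, a <= x <= b -> 0 <= g' x) -> g a <= g b.
Proof.
  intros hab hd hp.
  destruct (MVT_gen g a b g') as (x & hx & e).
  - intros x _; apply hd.
  - intros x _; apply continuity_pt_filterlim, (ex_derive_continuous g); eexists; apply hd.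
  - rewrite Rmin_left, Rmax_right in hx by assumption. assert (h := hp x hx). nra.
Qed.

(** The derivative of exp (-v/2) g v is at most (1/2 + |t|) exp (-v/2) in absolute value, a multiple
    of the derivative of the monotone envelope. Adding or subtracting the wave therefore leaves -W
    exp (-v/2) nondecreasing. *)
Lemma damped_wave_increment (g h : R -> R) (t a b : R) : a <= b ->
  (forall v, is_derive g v (t * h v)) ->
  (forall v, Rabs (g v) <= 1) -> (forall v, Rabs (h v) <= 1) ->
  Rabs (exp (- / 2 * b) * g b - exp (- / 2 * a) * g a)
  <= (1 + 2 * Rabs t) * (exp (- / 2 * a) - exp (- / 2 * b)).
Proof.
  intros hab hd hg hh.
  set (W := 1 + 2 * Rabs t).
  assert (hder : forall s v, is_derive (fun v => - W * exp (- / 2 * v) +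
     s * (exp (- / 2 * v) * g v)) v
     (exp (- / 2 * v) * (W / 2 + s * (t * h v - g v / 2)))).
  { intros s v. auto_derive; [eexists; apply hd|].
    assert (e : Derive (fun x : R => g x) v = t * h v) by apply is_derive_unique, hd.
    rewrite e; field. }
  assert (hpos : forall s v, Rabs s <= 1 ->
    0 <= exp (- / 2 * v) * (W / 2 + s * (t * h v - g v / 2))).
  { intros s v hs; apply Rmult_le_pos; [apply Rlt_le, exp_pos|].
    assert (h1 : Rabs (s * (t * h v - g v / 2)) <= 1 * (Rabs t + / 2)).
    { rewrite Rabs_mult; apply Rmult_le_compat; try apply Rabs_pos; [exact hs|].
      eapply Rle_trans; [apply Rabs_triang|].
      rewrite Rabs_Ropp; unfold Rdiv; rewrite !Rabs_mult, (Rabs_right (/ 2)) by lra.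
      specialize (hg v); specialize (hh v). assert (h1 := Rabs_pos t).
      assert (h2 := Rabs_pos (h v)). nra. }
    apply Rabs_le_between in h1. unfold W; lra. }
  assert (h1 := nondecreasing_of_deriv _ _ a b hab (hder 1)
    (fun v _ => hpos 1 v ltac:(rewrite Rabs_R1; lra))).
  assert (h2 := nondecreasing_of_deriv _ _ a b hab (hder (-1))
    (fun v _ => hpos (-1) v ltac:(apply Rabs_le_between; lra))).
  cbv beta in h1, h2. apply Rabs_le_between; lra.
Qed.

Definition eta_re (N : nat) (t : R) : R := fst (eta_partial N (/ 2, t)).
Definition eta_im (N : nat) (t : R) : R := snd (eta_partial N (/ 2, t)).

Lemma eta_re_S (N : nat) (t : R) :
  eta_re (S N) t = eta_re N t + (-1) ^ N * (isqrt (S N) * cos (t * ln (INR (S N)))).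
Proof. unfold eta_re, isqrt. cbn -[INR pow]. ring. Qed.

Lemma eta_im_S (N : nat) (t : R) :
  eta_im (S N) t = eta_im N t + (-1) ^ N * (isqrt (S N) * - sin (t * ln (INR (S N)))).
Proof. unfold eta_im, isqrt. cbn -[INR pow]. ring. Qed.

(** The terms are n^(-1/2) times a wave of frequency t in ln n, so their increments are controlled
    by those of n^(-1/2). The explicit, linear dependence on |t| gives locally uniform convergence
    and polynomial growth at once. *)
Lemma eta_part_cauchy (a : nat -> R) (g h : R -> R) (t : R) :
  (forall v, is_derive g v (t * h v)) ->
  (forall v, Rabs (g v) <= 1) -> (forall v, Rabs (h v) <= 1) ->
  (forall k, a (S k) = a k + (-1) ^ k * (isqrt (S k) * g (ln (INR (S k))))) ->
  forall N M, (1 <= N)%nat -> (N <= M)%nat ->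
  Rabs (a M - a N) <= (1 + 2 * Rabs t) * isqrt N.
Proof.
  intros hd hg hh ha.
  assert (ht := Rabs_pos t).
  apply (alternating_cauchy a (fun n => isqrt n * g (ln (INR n))) isqrt); [lra|exact ha| |].
  - intros n hn; rewrite Rabs_mult.
    assert (h1 := exp_pos (- / 2 * ln (INR n))). fold (isqrt n) in h1.
    rewrite (Rabs_right (isqrt n)) by lra. specialize (hg (ln (INR n))).
    assert (h2 := Rabs_pos (g (ln (INR n)))). nra.
  - intros n hn; apply (damped_wave_increment g h t); try assumption.
    apply ln_le; [apply lt_0_INR; lia|apply le_INR; lia].
Qed.

Lemma eta_re_cauchy (t : R) (N M : nat) : (1 <= N)%nat -> (N <= M)%nat ->
  Rabs (eta_re M t - eta_re N t) <= (1 + 2 * Rabs t) * isqrt N.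
Proof.
  apply (eta_part_cauchy (fun n => eta_re n t) (fun v => cos (t * v)) (fun v => - sin (t * v))).
  - intros v; auto_derive; [exact I|ring].
  - intros v; apply Rabs_le_between; assert (h := COS_bound (t * v)); lra.
  - intros v; apply Rabs_le_between; assert (h := SIN_bound (t * v)); lra.
  - intros k; apply eta_re_S.
Qed.

Lemma eta_im_cauchy (t : R) (N M : nat) : (1 <= N)%nat -> (N <= M)%nat ->
  Rabs (eta_im M t - eta_im N t) <= (1 + 2 * Rabs t) * isqrt N.
Proof.
  apply (eta_part_cauchy (fun n => eta_im n t) (fun v => - sin (t * v)) (fun v => - cos (t * v))).
  - intros v; auto_derive; [exact I|ring].
  - intros v; apply Rabs_le_between; assert (h := SIN_bound (t * v)); lra.
  - intros v; apply Rabs_le_between; assert (h := COS_bound (t * v)); lra.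
  - intros k; apply eta_im_S.
Qed.

(** The estimate forces convergence, so [real (Lim_seq a)] is the true limit and not a default
    value. *)
Lemma cauchy_rate_limit (a : nat -> R) (W : R) : 0 <= W ->
  (forall N M, (1 <= N)%nat -> (N <= M)%nat -> Rabs (a M - a N) <= W * isqrt N) ->
  forall N, (1 <= N)%nat -> Rabs (real (Lim_seq a) - a N) <= W * isqrt N.
Proof.
  intros hW h.
  assert (hex : ex_finite_lim_seq a).
  { apply ex_lim_seq_cauchy_corr. intros eps.
    destruct (isqrt_small (eps / (2 * W + 1))) as (N & hN & hs).
    { apply Rdiv_lt_0_compat; [apply cond_pos|lra]. }
    exists N; intros n m hn hm.
    apply Rlt_div_r in hs; [|lra].
    assert (h1 := h N n hN hn). assert (h2 := h N m hN hm).
    replace (a n - a m) with ((a n - a N) + - (a m - a N)) by ring.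
    eapply Rle_lt_trans; [apply Rabs_triang|]. rewrite Rabs_Ropp.
    assert (h3 := exp_pos (- / 2 * ln (INR N))). fold (isqrt N) in h3. nra. }
  apply Lim_seq_correct' in hex.
  intros N hN.
  assert (h1 : is_lim_seq (fun n => Rabs (a n - a N)) (Rabs (real (Lim_seq a) - a N))).
  { apply (is_lim_seq_abs _ (Finite (real (Lim_seq a) - a N))).
    apply is_lim_seq_minus'; [exact hex|apply is_lim_seq_const]. }
  apply (is_lim_seq_le_loc (fun n => Rabs (a n - a N)) (fun _ => W * isqrt N)
    (Finite (Rabs (real (Lim_seq a) - a N))) (Finite (W * isqrt N)));
    [|exact h1|apply is_lim_seq_const].
  exists N; intros n hn; now apply h.
Qed.

Lemma continuous_rate_limit (a : nat -> R -> R) (l : R -> R) :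
  (forall N t, continuous (a N) t) ->
  (forall N t, (1 <= N)%nat -> Rabs (l t - a N t) <= (1 + 2 * Rabs t) * isqrt N) ->
  forall t, continuous l t.
Proof.
  intros hc hl t.
  apply continuity_pt_filterlim; intros eps heps.
  (* This bounds 1 + 2 |x| for all x within 1 of t, so one N serves the whole neighbourhood. *)
  set (W := 3 + 2 * Rabs t). assert (ht := Rabs_pos t).
  destruct (isqrt_small (eps / (3 * W))) as (N & hN & hs).
  { apply Rdiv_lt_0_compat; unfold W; lra. }
  apply Rlt_div_r in hs; [|unfold W; lra].
  assert (h1 := hc N t). apply continuity_pt_filterlim in h1.
  destruct (h1 (eps / 3) ltac:(lra)) as (al & hal & h2).
  exists (Rmin al 1); split; [apply Rmin_pos; lra|].
  intros x [hx hd]. simpl in hd |- *. unfold Rdist in hd |- *.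
  assert (hd1 := Rlt_le_trans _ _ _ hd (Rmin_l _ _)).
  assert (hd2 := Rlt_le_trans _ _ _ hd (Rmin_r _ _)).
  specialize (h2 x (conj hx hd1)). simpl in h2. unfold Rdist in h2.
  assert (hxt : Rabs x <= Rabs t + 1).
  { replace x with (t + (x - t)) by ring. eapply Rle_trans; [apply Rabs_triang|]. lra. }
  assert (h3 := exp_pos (- / 2 * ln (INR N))). fold (isqrt N) in h3.
  assert (h4 := hl N x hN). assert (h5 := hl N t hN).
  replace (l x - l t) with ((l x - a N x) + ((a N x - a N t) + - (l t - a N t))) by ring.
  eapply Rle_lt_trans; [apply Rabs_triang|].
  assert (h6 := Rabs_triang (a N x - a N t) (- (l t - a N t))).
  rewrite Rabs_Ropp in h6.
  assert ((1 + 2 * Rabs x) * isqrt N <= W * isqrt N) by (unfold W; nra).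
  assert ((1 + 2 * Rabs t) * isqrt N <= W * isqrt N) by (unfold W; nra).
  lra.
Qed.

Definition ere (t : R) : R := real (Lim_seq (fun N => eta_re N t)).
Definition eim (t : R) : R := real (Lim_seq (fun N => eta_im N t)).

Lemma ere_rate (N : nat) (t : R) : (1 <= N)%nat ->
  Rabs (ere t - eta_re N t) <= (1 + 2 * Rabs t) * isqrt N.
Proof.
  apply cauchy_rate_limit; [assert (h := Rabs_pos t); lra|intros; now apply eta_re_cauchy].
Qed.

Lemma eim_rate (N : nat) (t : R) : (1 <= N)%nat ->
  Rabs (eim t - eta_im N t) <= (1 + 2 * Rabs t) * isqrt N.
Proof.
  apply cauchy_rate_limit; [assert (h := Rabs_pos t); lra|intros; now apply eta_im_cauchy].
Qed.

Lemma continuous_eta_re (N : nat) (t : R) : continuous (eta_re N) t.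
Proof.
  induction N as [|N IH]; [apply (continuous_const (0 : R))|].
  apply (continuous_ext (fun t => eta_re N t +
    (-1) ^ N * (isqrt (S N) * cos (t * ln (INR (S N)))))).
  { intros s; symmetry; apply eta_re_S. }
  apply (continuous_plus (eta_re N)); [exact IH|].
  generalize (ln (INR (S N))) (isqrt (S N)) ((-1) ^ N); intros x y w.
  apply (ex_derive_continuous (fun t => w * (y * cos (t * x)))); auto_derive; exact I.
Qed.

Lemma continuous_eta_im (N : nat) (t : R) : continuous (eta_im N) t.
Proof.
  induction N as [|N IH]; [apply (continuous_const (0 : R))|].
  apply (continuous_ext (fun t => eta_im N t +
    (-1) ^ N * (isqrt (S N) * - sin (t * ln (INR (S N)))))).
  { intros s; symmetry; apply eta_im_S. }
  apply (continuous_plus (eta_im N)); [exact IH|].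
  generalize (ln (INR (S N))) (isqrt (S N)) ((-1) ^ N); intros x y w.
  apply (ex_derive_continuous (fun t => w * (y * - sin (t * x)))); auto_derive; exact I.
Qed.

Lemma continuous_ere (t : R) : continuous ere t.
Proof. apply (continuous_rate_limit eta_re); [apply continuous_eta_re|apply ere_rate]. Qed.

Lemma continuous_eim (t : R) : continuous eim t.
Proof. apply (continuous_rate_limit eta_im); [apply continuous_eta_im|apply eim_rate]. Qed.

Lemma isqrt_1 : isqrt 1 = 1.
Proof. unfold isqrt; simpl INR; rewrite ln_1, Rmult_0_r; apply exp_0. Qed.

(** The rate at N = 1, where the partial sum is 1. *)
Lemma ere_bound (t : R) : Rabs (ere t) <= 2 * (1 + Rabs t).
Proof.
  assert (h := ere_rate 1 t ltac:(lia)). rewrite eta_re_S, isqrt_1 in h.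
  simpl INR in h; rewrite ln_1, Rmult_0_r, cos_0 in h.
  unfold eta_re in h; simpl in h.
  replace (ere t) with ((ere t - (0 + 1 * (1 * 1))) + 1) by ring.
  eapply Rle_trans; [apply Rabs_triang|]. rewrite Rabs_R1; lra.
Qed.

Lemma eim_bound (t : R) : Rabs (eim t) <= 2 * (1 + Rabs t).
Proof.
  assert (h := eim_rate 1 t ltac:(lia)). rewrite eta_im_S, isqrt_1 in h.
  simpl INR in h; rewrite ln_1, Rmult_0_r, sin_0 in h.
  unfold eta_im in h; simpl in h.
  replace (eim t) with (eim t - (0 + 1 * (1 * - 0))) by ring. lra.
Qed.

(** The squared modulus of 1 - 2^(1-s) at s = 1/2 + it. It never vanishes, since |2^(1-s)| = sqrt
    2. *)
Definition zeta_den (t : R) : R := 1 - 4 * isqrt 2 * cos (t * ln 2) + 2.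

Lemma isqrt_2 : isqrt 2 * isqrt 2 = / 2.
Proof.
  unfold isqrt; rewrite <- exp_plus; replace (INR 2) with 2 by reflexivity.
  replace (- / 2 * ln 2 + - / 2 * ln 2) with (- ln 2) by field.
  rewrite exp_Ropp, exp_ln; lra.
Qed.

Lemma zeta_den_pos (t : R) : / 10 <= zeta_den t.
Proof.
  unfold zeta_den. assert (h := isqrt_2). assert (h1 := exp_pos (- / 2 * ln (INR 2))).
  (* The minimum of the denominator is 3 - 4 2^(-1/2), and 3 - 4 * 0.725 = 1/10. *)
  fold (isqrt 2) in h1. assert (isqrt 2 <= 0.725) by nra.
  assert (h2 := COS_bound (t * ln 2)). nra.
Qed.

Lemma Z2_eq (t : R) : Z2 t = (ere t ^ 2 + eim t ^ 2) / zeta_den t.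
Proof.
  unfold Z2, zeta.
  set (dn := Cminus 1%C (Cmult (RtoC 2) (npow_neg 2 (/ 2, t)))).
  assert (hsq : forall w : C, Cmod w ^ 2 = fst w ^ 2 + snd w ^ 2).
  { intros w; unfold Cmod; apply pow2_sqrt.
    assert (h1 := pow2_ge_0 (fst w)). assert (h2 := pow2_ge_0 (snd w)). lra. }
  assert (hdn : Cmod dn ^ 2 = zeta_den t).
  { rewrite hsq. unfold dn, zeta_den. cbn -[INR pow].
    replace (INR 2) with 2 by reflexivity.
    replace (exp (- / 2 * ln 2)) with (isqrt 2) by reflexivity.
    assert (h := isqrt_2). assert (h2 := sin2_cos2 (t * ln 2)). unfold Rsqr in h2.
    set (c := cos (t * ln 2)) in *. set (s := sin (t * ln 2)) in *. set (i := isqrt 2) in *.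
    match goal with |- ?x = _ =>
      replace x with (1 - 4 * i * c + 4 * (i * i) * (s * s + c * c)) by ring end.
    rewrite h, h2; field. }
  assert (hpos := zeta_den_pos t).
  assert (hne : dn <> 0%C).
  { intros e; rewrite e, Cmod_0 in hdn; simpl in hdn; lra. }
  rewrite Cmod_div by exact hne.
  unfold Rdiv. rewrite Rpow_mult_distr, pow_inv, hdn, hsq. reflexivity.
Qed.

Lemma Z2_nonneg (t : R) : 0 <= Z2 t.
Proof. apply pow2_ge_0. Qed.

(** Any polynomial bound serves, since it is only used against a Gaussian factor. *)
Lemma Z2_bound (t : R) : Z2 t <= 80 * (1 + Rabs t) ^ 2.
Proof.
  rewrite Z2_eq. assert (hd := zeta_den_pos t).
  assert (h1 : forall x, Rabs x <= 2 * (1 + Rabs t) -> x ^ 2 <= 4 * (1 + Rabs t) ^ 2).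
  { intros x hx. rewrite <- (pow2_abs x). assert (h := Rabs_pos x). nra. }
  assert (h2 := h1 _ (ere_bound t)). assert (h3 := h1 _ (eim_bound t)).
  apply Rle_div_l; [lra|].
  assert (h4 := pow2_ge_0 (1 + Rabs t)). nra.
Qed.

Lemma continuous_Z2 (t : R) : continuous Z2 t.
Proof.
  apply (continuous_ext (fun t => (ere t ^ 2 + eim t ^ 2) * / zeta_den t)).
  { intros s; symmetry; apply Z2_eq. }
  apply (continuous_mult (fun t => ere t ^ 2 + eim t ^ 2) (fun t => / zeta_den t)).
  - apply (continuous_plus (fun t => ere t ^ 2) (fun t => eim t ^ 2)).
    + apply (continuous_ext (fun t => ere t * ere t));
        [intros s; change (ere s * ere s = ere s ^ 2); ring|].
      apply (continuous_mult ere ere); apply continuous_ere.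
    + apply (continuous_ext (fun t => eim t * eim t));
        [intros s; change (eim s * eim s = eim s ^ 2); ring|].
      apply (continuous_mult eim eim); apply continuous_eim.
  - apply (continuous_comp zeta_den Rinv).
    + unfold zeta_den; apply (ex_derive_continuous
        (fun t => 1 - 4 * isqrt 2 * cos (t * ln 2) + 2)); auto_derive; exact I.
    + apply continuity_pt_filterlim, continuity_pt_inv; [apply continuity_pt_id|].
      assert (h := zeta_den_pos t). unfold id; lra.
Qed.

(** * Gaussian smoothing *)

Lemma ex_RInt_cont (f : R -> R) (a b : R) : (forall x, continuous f x) -> ex_RInt f a b.
Proof. intros h; apply (ex_RInt_continuous f); intros; apply h. Qed.

Lemma is_derive_primitive (f : R -> R) (a x : R) : (forall y, continuous f y) ->
  is_derive (fun x => RInt f a x) x (f x).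
Proof.
  intros h; apply (is_derive_RInt f _ a); [|apply h].
  apply filter_forall; intros y; apply (RInt_correct f), ex_RInt_cont, h.
Qed.

Lemma monotone_limit (F : R -> R) (V M : R) :
  (forall x y, x <= y -> F x <= F y) -> (forall x, V <= x -> F x <= M) ->
  exists l, F V <= l <= M /\
    forall eps, 0 < eps -> exists x0, forall x, x0 < x -> Rabs (F x - l) < eps.
Proof.
  intros hF hM.
  destruct (completeness (fun y => exists x, y = F x)) as [l [hub hlub]].
  - exists M; intros y [x ->]. destruct (Rle_lt_dec V x) as [h|h]; [now apply hM|].
    apply Rle_trans with (F V); [apply hF; lra|apply hM; lra].
  - exists (F V), V; reflexivity.
  - exists l; split; [split|].
    + apply hub; exists V; reflexivity.
    + apply hlub; intros y [x ->]. destruct (Rle_lt_dec V x) as [h|h]; [now apply hM|].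
      apply Rle_trans with (F V); [apply hF; lra|apply hM; lra].
    + intros eps heps.
      destruct (excluded_middle_informative (exists x0, l - eps < F x0)) as [[x0 hx0]|h].
      * exists x0; intros x hx.
        assert (h1 := hF x0 x ltac:(lra)).
        assert (h2 : F x <= l) by (apply hub; exists x; reflexivity).
        apply Rabs_def1; lra.
      * exfalso. assert (l <= l - eps); [|lra].
        apply hlub; intros y [x ->]. apply Rnot_lt_le; intros h1; apply h; now exists x.
Qed.

(** The increments of the integral of f are compared with those of -(Q / lam) exp (-lam x), a
    primitive of the majorant. *)
Lemma RInt_tail_exp (f : R -> R) (V b Q lam : R) : 0 < lam -> V <= b ->
  (forall x, continuous f x) ->
  (forall u, V <= u -> f u <= Q * exp (- (lam * u))) ->
  RInt f 0 b <= RInt f 0 V + Q / lam * exp (- (lam * V)) - Q / lam * exp (- (lam * b)).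
Proof.
  intros hlam hVb hc hf.
  assert (h := nondecreasing_of_deriv
    (fun x => - (Q / lam * exp (- (lam * x))) - RInt f 0 x)
    (fun x => Q * exp (- (lam * x)) - f x) V b hVb).
  cbv beta in h. lapply h; [clear h; intros h; lapply h; [lra|]|].
  - intros x hx. assert (h1 := hf x ltac:(lra)). lra.
  - intros x. apply (is_derive_minus (fun x => - (Q / lam * exp (- (lam * x))))
      (fun x => RInt f 0 x)).
    + auto_derive; [exact I|field; lra].
    + now apply is_derive_primitive.
Qed.

(** For nonnegative f the primitive F is monotone, so the tail bound gives it finite limits at both
    infinities, and the improper integral is their difference. The negative half-line is treated by
    reflection. *)
Lemma RInt_gen_nonneg_tail (f : R -> R) (V Q lam : R) : 0 <= V -> 0 < lam -> 0 <= Q ->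
  (forall x, continuous f x) -> (forall x, 0 <= f x) ->
  (forall u, V <= Rabs u -> f u <= Q * exp (- (lam * Rabs u))) ->
  exists l, is_RInt_gen f (Rbar_locally m_infty) (Rbar_locally p_infty) l /\
    RInt f (- V) V <= l <= RInt f (- V) V + 2 * (Q / lam * exp (- (lam * V))).
Proof.
  intros hV hlam hQ hc hp hf.
  set (F := fun x => RInt f 0 x).
  assert (hex : forall a b, ex_RInt f a b) by (intros; now apply ex_RInt_cont).
  assert (hmono : forall x y, x <= y -> F x <= F y).
  { intros x y hxy. apply (nondecreasing_of_deriv F f x y hxy).
    - intros z; now apply is_derive_primitive.
    - intros z _; apply hp. }
  assert (hcr : forall x, continuous (fun x => f (- x)) x).
  { intros x; apply (continuous_comp (fun x : R => - x) f); [|apply hc].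
    apply (continuous_opp (fun x : R => x)), continuous_id. }
  assert (hrev : forall x, RInt (fun x => f (- x)) 0 x = - F (- x)).
  { intros x.
    apply is_RInt_unique.
    apply (is_RInt_ext (fun y => opp (opp (f (- y))))).
    { intros y _. apply Ropp_involutive. }
    apply (is_RInt_opp (fun y => opp (f (- y))) 0 x (F (- x))), (is_RInt_comp_opp f 0 x).
    rewrite Ropp_0. apply (RInt_correct f), hex. }
  assert (he : forall b, 0 <= Q / lam * exp (- (lam * b))).
  { intros b; apply Rmult_le_pos; [apply Rle_mult_inv_pos; lra|apply Rlt_le, exp_pos]. }
  destruct (monotone_limit F V (F V + Q / lam * exp (- (lam * V)))) as (lp & hlp & hlimp).
  { exact hmono. }
  { intros x hx. assert (h := RInt_tail_exp f V x Q lam hlam hx hc).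
    lapply h; [clear h; intros h; specialize (he x); fold (F x) (F V) in h; lra|].
    intros u hu. rewrite <- (Rabs_right u) at 2 by lra. apply hf. rewrite Rabs_right; lra. }
  destruct (monotone_limit (fun x => - F (- x)) V (- F (- V) + Q / lam * exp (- (lam * V))))
    as (lm & hlm & hlimm).
  { intros x y hxy. assert (h := hmono (- y) (- x) ltac:(lra)). lra. }
  { intros x hx. assert (h := RInt_tail_exp (fun x => f (- x)) V x Q lam hlam hx hcr).
    lapply h; [clear h; intros h; specialize (he x); rewrite !hrev in h; lra|].
    intros u hu. rewrite <- (Rabs_right u) at 2 by lra. rewrite <- Rabs_Ropp.
    apply hf. rewrite Rabs_Ropp, Rabs_right; lra. }
  cbv beta in hlm.
  (* [lm] is the limit of -F(-x), so F tends to -lm at minus infinity. *)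
  exists (lp - - lm); split.
  - apply (is_RInt_gen_ext (Derive F)).
    { apply filter_forall; intros ab x _. apply is_derive_unique; now apply is_derive_primitive. }
    apply is_RInt_gen_Derive.
    + apply filter_forall; intros ab x _. eexists; now apply is_derive_primitive.
    + apply filter_forall; intros ab x _. apply (continuous_ext f); [|apply hc].
      intros y; symmetry; apply is_derive_unique; now apply is_derive_primitive.
    + apply filterlim_locally; intros eps.
      destruct (hlimm eps (cond_pos eps)) as [x0 hx0]. exists (- x0); intros x hx.
      change (Rabs (F x - - lm) < eps).
      specialize (hx0 (- x) ltac:(lra)). rewrite Ropp_involutive in hx0.
      rewrite <- Rabs_Ropp. replace (- (F x - - lm)) with (- F x - lm) by ring. exact hx0.
    + apply filterlim_locally; intros eps.
      destruct (hlimp eps (cond_pos eps)) as [x0 hx0]. exists x0; intros x hx.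
      change (Rabs (F x - lp) < eps). now apply hx0.
  - assert (h := RInt_Chasles f (- V) 0 V (hex _ _) (hex _ _)).
    change (RInt f (- V) 0 + F V = RInt f (- V) V) in h.
    assert (h2 := opp_RInt_swap f 0 (- V) (hex _ _)).
    change (- F (- V) = RInt f (- V) 0) in h2. lra.
Qed.

Definition gauss (G u : R) : R := exp (- (u / G) ^ 2).

Lemma gauss_even (G u : R) : gauss G (- u) = gauss G u.
Proof. unfold gauss; f_equal; unfold Rdiv; ring. Qed.

Lemma gauss_abs (G u : R) : 0 < G -> gauss G u = exp (- (Rabs u / G) ^ 2).
Proof.
  intros hG; unfold gauss; f_equal; f_equal.
  rewrite <- (pow2_abs (u / G)); f_equal. unfold Rdiv; rewrite Rabs_mult.
  now rewrite (Rabs_right (/ G)) by (apply Rle_ge, Rlt_le, Rinv_0_lt_compat, hG).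
Qed.

Lemma continuous_gauss (G u : R) : continuous (gauss G) u.
Proof.
  unfold gauss; apply (ex_derive_continuous (fun u => exp (- (u / G) ^ 2))).
  auto_derive; exact I.
Qed.

Lemma gauss_pos (G u : R) : 0 < gauss G u.
Proof. apply exp_pos. Qed.

Lemma gauss_le_1 (G u : R) : gauss G u <= 1.
Proof.
  unfold gauss; rewrite <- exp_0; apply exp_le_compat.
  assert (h := pow2_ge_0 (u / G)); lra.
Qed.

Lemma sq_le_4_exp (y : R) : 0 <= y -> y ^ 2 <= 4 * exp y.
Proof.
  intros hy. assert (h := exp_ineq1_le (y / 2)).
  assert (e : exp y = exp (y / 2) * exp (y / 2)) by (rewrite <- exp_plus; f_equal; field).
  rewrite e. nra.
Qed.

Lemma continuous_shift (f : R -> R) (t u : R) : (forall x, continuous f x) ->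
  continuous (fun u => f (t + u)) u.
Proof.
  intros h; apply (continuous_comp (fun u : R => t + u) f); [|apply h].
  apply (continuous_plus (fun _ : R => t) (fun u : R => u));
    [apply continuous_const|apply continuous_id].
Qed.

Lemma continuous_smoothed (G t u : R) : continuous (fun u => Z2 (t + u) * gauss G u) u.
Proof.
  apply (continuous_mult (fun u => Z2 (t + u)) (gauss G)); [|apply continuous_gauss].
  apply continuous_shift, continuous_Z2.
Qed.

Lemma Z2_shift_bound (tau t u : R) : Rabs t <= tau ->
  Z2 (t + u) <= 160 * ((1 + tau) ^ 2 + Rabs u ^ 2).
Proof.
  intros ht. eapply Rle_trans; [apply Z2_bound|].
  assert (h := Rabs_triang t u). assert (h1 := Rabs_pos (t + u)).
  assert (h2 := Rabs_pos t). assert (h3 := Rabs_pos u).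
  apply Rle_trans with (80 * (1 + tau + Rabs u) ^ 2).
  - apply Rmult_le_compat_l; [lra|]. apply pow_incr; lra.
  - assert (h4 := pow2_ge_0 (1 + tau - Rabs u)). nra.
Qed.

(** With y = |u| / G, (y - 1)^2 >= 0 gives exp (-y^2) <= e exp (-2 y): one factor exp (-y) absorbs
    the quadratic growth of [Z2], the other remains as the tail. Being uniform in |t| <= tau, the
    bound serves convergence and continuity in t, where its size is irrelevant. *)
Lemma smoothed_tail_crude (G tau t u : R) : 0 < G -> Rabs t <= tau ->
  Z2 (t + u) * gauss G u <=
  160 * exp 1 * ((1 + tau) ^ 2 + 4 * G ^ 2) * exp (- (/ G * Rabs u)).
Proof.
  intros hG ht.
  assert (h1 := Z2_shift_bound tau t u ht). rewrite gauss_abs by assumption.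
  set (y := Rabs u / G).
  assert (hy : 0 <= y) by (unfold y; apply Rle_mult_inv_pos; [apply Rabs_pos|exact hG]).
  assert (hu : Rabs u = G * y) by (unfold y; field; lra).
  rewrite hu in *. replace (/ G * (G * y)) with y by (field; lra).
  assert (h2 : exp (- y ^ 2) <= exp 1 * (exp (- y) * exp (- y))).
  { rewrite <- !exp_plus; apply exp_le_compat. assert (h := pow2_ge_0 (y - 1)). nra. }
  assert (h3 := sq_le_4_exp y hy).
  assert (h4 : exp y * exp (- y) = 1) by (rewrite <- exp_plus, Rplus_opp_r; apply exp_0).
  assert (h5 := exp_pos (- y)). assert (h6 := exp_pos 1).
  assert (h7 : exp (- y) <= 1) by (rewrite <- exp_0; apply exp_le_compat; lra).
  assert (h8 : y ^ 2 * exp (- y) <= 4) by nra.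
  assert (h9 : 0 <= (1 + tau) ^ 2 + (G * y) ^ 2) by
    (assert (h := pow2_ge_0 (1 + tau)); assert (h' := pow2_ge_0 (G * y)); lra).
  apply Rle_trans with (160 * ((1 + tau) ^ 2 + (G * y) ^ 2) * (exp 1 * (exp (- y) * exp (- y)))).
  - apply Rmult_le_compat; [apply Z2_nonneg|apply Rlt_le, exp_pos|exact h1|exact h2].
  - apply Rle_trans with ((160 * exp 1 * exp (- y)) *
      ((1 + tau) ^ 2 * exp (- y) + G ^ 2 * (y ^ 2 * exp (- y)))); [right; ring|].
    apply Rle_trans with ((160 * exp 1 * exp (- y)) * ((1 + tau) ^ 2 * 1 + G ^ 2 * 4));
      [|right; ring].
    apply Rmult_le_compat_l; [repeat apply Rmult_le_pos; lra|].
    apply Rplus_le_compat; apply Rmult_le_compat_l; try apply pow2_ge_0; lra.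
Qed.

Definition smoothed (G t : R) : R :=
  RInt_gen (fun u => Z2 (t + u) * gauss G u) (Rbar_locally m_infty) (Rbar_locally p_infty).

Lemma J1_eq (t G : R) : J1 t G = / (sqrt PI * G) * smoothed G t.
Proof. reflexivity. Qed.

Lemma smoothed_bounds (G t V Q lam : R) : 0 <= V -> 0 < lam -> 0 <= Q ->
  (forall u, V <= Rabs u -> Z2 (t + u) * gauss G u <= Q * exp (- (lam * Rabs u))) ->
  let I := RInt (fun u => Z2 (t + u) * gauss G u) (- V) V in
  I <= smoothed G t <= I + 2 * (Q / lam * exp (- (lam * V))).
Proof.
  intros hV hlam hQ hf I.
  destruct (RInt_gen_nonneg_tail (fun u => Z2 (t + u) * gauss G u) V Q lam) as (l & hl & hb);
    try assumption.
  - intros x; apply continuous_smoothed.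
  - intros x; apply Rmult_le_pos; [apply Z2_nonneg|apply Rlt_le, gauss_pos].
  - unfold smoothed.
    rewrite (is_RInt_gen_unique (fun u => Z2 (t + u) * gauss G u) l hl). exact hb.
Qed.

Lemma continuous_truncated (G V t : R) : 0 < V ->
  continuous (fun t => RInt (fun u => Z2 (t + u) * gauss G u) (- V) V) t.
Proof.
  intros hV.
  apply continuity_pt_filterlim; intros eps heps.
  destruct (@Heine_cor2 Z2 (t - V - 1) (t + V + 1)
    (fun x _ => proj2 (continuity_pt_filterlim Z2 x) (continuous_Z2 x))
    (mkposreal (eps / (4 * V)) ltac:(apply Rdiv_lt_0_compat; lra))) as [del hdel].
  simpl in hdel.
  exists (Rmin del 1); split; [apply Rmin_pos; [apply cond_pos|lra]|].
  intros x [_ hd]. simpl in hd |- *. unfold Rdist in hd |- *.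
  assert (hd1 := Rlt_le_trans _ _ _ hd (Rmin_l _ _)).
  assert (hd2 := Rlt_le_trans _ _ _ hd (Rmin_r _ _)).
  apply Rabs_lt_between in hd2.
  assert (hex : forall s, ex_RInt (fun u => Z2 (s + u) * gauss G u) (- V) V).
  { intros s; apply ex_RInt_cont; intros; apply continuous_smoothed. }
  assert (hm := RInt_minus _ _ _ _ (hex x) (hex t)).
  match type of hm with ?a = _ => change (a =
    RInt (fun u => Z2 (x + u) * gauss G u) (- V) V -
    RInt (fun u => Z2 (t + u) * gauss G u) (- V) V) in hm end.
  rewrite <- hm.
  apply Rle_lt_trans with ((V - - V) * (eps / (4 * V))).
  - apply abs_RInt_le_const; [lra|apply (ex_RInt_minus (V := R_NormedModule)); apply hex|].
    intros u hu.
    change (Rabs (Z2 (x + u) * gauss G u - Z2 (t + u) * gauss G u) <= eps / (4 * V)).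
    rewrite <- Rmult_minus_distr_r, Rabs_mult.
    assert (hg := gauss_pos G u). assert (hg1 := gauss_le_1 G u).
    rewrite (Rabs_right (gauss G u)) by lra.
    assert (h := hdel (x + u) (t + u) ltac:(lra) ltac:(lra)
      ltac:(replace (x + u - (t + u)) with (x - t) by ring; exact hd1)).
    assert (h' := Rabs_pos (Z2 (x + u) - Z2 (t + u))). nra.
  - replace ((V - - V) * (eps / (4 * V))) with (eps / 2) by (field; lra). lra.
Qed.

(** The truncated integrals are continuous and approximate uniformly near t. Continuity makes the
    outer Riemann integral of the moment exist. *)
Lemma continuous_smoothed_t (G t : R) : 0 < G -> continuous (smoothed G) t.
Proof.
  intros hG.
  set (tau := Rabs t + 1).
  set (Q := 160 * exp 1 * ((1 + tau) ^ 2 + 4 * G ^ 2)).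
  assert (hQ : 0 <= Q).
  { unfold Q; assert (h := exp_pos 1); apply Rmult_le_pos; [lra|].
    assert (h1 := pow2_ge_0 (1 + tau)); assert (h2 := pow2_ge_0 G); lra. }
  assert (hlam : 0 < / G) by (apply Rinv_0_lt_compat, hG).
  apply continuity_pt_filterlim; intros eps heps.
  assert (hV : exists V, 0 < V /\ 2 * (Q / / G * exp (- (/ G * V))) <= eps / 3).
  (* With r = 6 Q G / eps and V / G = r + 1, the inequality exp (r + 1) >= r brings the tail 2 Q G /
     exp (r + 1) below eps / 3. *)
  { exists (G * (6 * (Q * G) / eps + 1)).
    set (r := 6 * (Q * G) / eps).
    assert (hr : 0 <= r) by (unfold r; apply Rle_mult_inv_pos; nra).
    split; [nra|].
    replace (/ G * (G * (r + 1))) with (r + 1) by (field; lra).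
    rewrite exp_Ropp.
    assert (h := exp_ineq1_le (r + 1)). assert (h0 := exp_pos (r + 1)).
    replace (2 * (Q / / G * / exp (r + 1))) with ((2 * (Q * G)) / exp (r + 1)) by (field; lra).
    apply Rle_div_l; [exact h0|].
    assert (e : 2 * (Q * G) = eps / 3 * r) by (unfold r; field; lra).
    rewrite e. apply Rmult_le_compat_l; lra. }
  destruct hV as (V & hV & hsm).
  assert (hb : forall s, Rabs s <= tau ->
    RInt (fun u => Z2 (s + u) * gauss G u) (- V) V <= smoothed G s <=
    RInt (fun u => Z2 (s + u) * gauss G u) (- V) V + eps / 3).
  { intros s hs. assert (h := smoothed_bounds G s V Q (/ G) ltac:(lra) hlam hQ
      (fun u _ => smoothed_tail_crude G tau s u hG hs)). cbv zeta in h. lra. }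
  assert (hc := continuous_truncated G V t hV).
  apply continuity_pt_filterlim in hc.
  destruct (hc (eps / 3) ltac:(lra)) as (al & hal & h2).
  exists (Rmin al 1); split; [apply Rmin_pos; lra|].
  intros x [hx hd]. simpl in hd |- *. unfold Rdist in hd |- *.
  assert (hd1 := Rlt_le_trans _ _ _ hd (Rmin_l _ _)).
  assert (hd2 := Rlt_le_trans _ _ _ hd (Rmin_r _ _)).
  specialize (h2 x (conj hx hd1)). simpl in h2. unfold Rdist in h2.
  assert (hxt : Rabs x <= tau).
  { unfold tau; replace x with (t + (x - t)) by ring.
    eapply Rle_trans; [apply Rabs_triang|]. lra. }
  assert (h3 := hb x hxt). assert (h4 := hb t ltac:(unfold tau; lra)).
  apply Rabs_lt_between in h2. apply Rabs_lt_between. lra.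
Qed.

Lemma smoothed_nonneg (G t : R) : 0 < G -> 0 <= smoothed G t.
Proof.
  intros hG.
  (* Truncation at V = 0 leaves an empty integral as the lower bound. *)
  assert (h := smoothed_bounds G t 0 (160 * exp 1 * ((1 + Rabs t) ^ 2 + 4 * G ^ 2)) (/ G)
    ltac:(lra) ltac:(now apply Rinv_0_lt_compat)).
  lapply h; [clear h; intros h|].
  - lapply h; [clear h; intros h|intros u _; now apply smoothed_tail_crude, Rle_refl].
    cbv zeta in h. rewrite Ropp_0, RInt_point in h. change (@zero _) with 0 in h. apply h.
  - assert (h1 := exp_pos 1); apply Rmult_le_pos; [lra|].
    assert (h2 := pow2_ge_0 (1 + Rabs t)); assert (h3 := pow2_ge_0 G); lra.
Qed.

(** * The function [E_star] *)

Definition I2 (s : R) : R := RInt Z2 0 s.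

(** The step function A of the overview: 2 pi [Delta_star] with each [Delta] replaced by its sum
    [D]. *)
Definition divisor_steps (s : R) : R :=
  2 * PI * (- D (s / (2 * PI)) + 2 * D (2 * (s / (2 * PI))) - / 2 * D (4 * (s / (2 * PI)))).

(** This default value matters: G ln T may exceed T, so [E_star] is met at negative arguments, and
    the cancellation of main terms must hold there as well. *)
Lemma ln_nonpos (x : R) : x <= 0 -> ln x = 0.
Proof. intros h; unfold ln; destruct (Rlt_dec 0 x) as [h1|h1]; [exfalso; lra|reflexivity]. Qed.

(* The main terms [x (ln x + 2 gamma - 1)] of [E] and of [Delta_star] cancel. *)
Lemma E_star_eq (s : R) : E_star s = I2 s - divisor_steps s.
Proof.
  unfold E_star, E, Delta_star, Delta, I2, divisor_steps.
  assert (hpi := PI_RGT_0).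
  set (x := s / (2 * PI)). assert (hs : s = 2 * PI * x) by (unfold x; field; lra).
  assert (hln : - x * ln x + 4 * x * ln (2 * x) - 2 * x * ln (4 * x) = x * ln x).
  { destruct (Rle_lt_dec x 0) as [h|h].
    - rewrite !ln_nonpos by lra; ring.
    - replace (4 * x) with (2 * (2 * x)) by ring.
      rewrite (ln_mult 2 (2 * x)), (ln_mult 2 x) by lra. ring. }
  rewrite hs at 2.
  match goal with |- ?l = ?r => assert (e : l - r =
    2 * PI * ((- x * ln x + 4 * x * ln (2 * x) - 2 * x * ln (4 * x)) - x * ln x)) by field end.
  rewrite hln in e. lra.
Qed.

Lemma Int_part_div (y : R) (k : Z) (n : Z) : (0 < n)%Z -> IZR k < y < IZR k + 1 ->
  Int_part (y / IZR n) = (k / n)%Z.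
Proof.
  intros hn hy. symmetry; apply Int_part_spec.
  assert (h1 := Z.div_mod k n ltac:(lia)). assert (h2 := Z.mod_pos_bound k n hn).
  assert (hn0 : 0 < IZR n) by now apply IZR_lt.
  assert (h3 : IZR n * IZR (k / n) <= IZR k) by (rewrite <- mult_IZR; apply IZR_le; lia).
  assert (h4 : IZR k + 1 <= IZR n * (IZR (k / n) + 1)).
  { rewrite <- !plus_IZR, <- mult_IZR; apply IZR_le; lia. }
  split.
  - assert (y / IZR n < IZR (k / n) + 1); [|lra]. apply Rlt_div_l; lra.
  - apply Rle_div_r; lra.
Qed.

(** With y = 2 s / pi the three arguments of [D] are y / 4, y / 2 and y, whose integer parts depend
    only on that of y; hence cells of length pi / 2. *)
Lemma divisor_steps_cell (k : Z) : exists a, forall s,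
  PI / 2 * IZR k < s < PI / 2 * (IZR k + 1) -> divisor_steps s = a.
Proof.
  exists (2 * PI * (- sum_f_R0 (fun k => INR (ndiv k)) (Z.to_nat (k / 4)) +
    2 * sum_f_R0 (fun k => INR (ndiv k)) (Z.to_nat (k / 2)) -
    / 2 * sum_f_R0 (fun k => INR (ndiv k)) (Z.to_nat (k / 1)))).
  intros s hs. assert (hpi := PI_RGT_0).
  set (y := 2 * s / PI).
  assert (hy : IZR k < y < IZR k + 1).
  { unfold y; split; [apply Rlt_div_r|apply Rlt_div_l]; lra. }
  unfold divisor_steps, D.
  replace (s / (2 * PI)) with (y / 4) by (unfold y; field; lra).
  replace (2 * (y / 4)) with (y / 2) by field.
  replace (4 * (y / 4)) with (y / 1) by field.
  rewrite (Int_part_div y k 4), (Int_part_div y k 2), (Int_part_div y k 1) by (lia || exact hy).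
  reflexivity.
Qed.

Lemma is_derive_I2 (s : R) : is_derive I2 s (Z2 s).
Proof. apply is_derive_primitive, continuous_Z2. Qed.

Lemma continuous_I2 (s : R) : continuous I2 s.
Proof. apply (ex_derive_continuous I2); eexists; apply is_derive_I2. Qed.

Lemma ex_RInt_cells (f : R -> R) (h : R) : 0 < h ->
  (forall k : Z, ex_RInt f (h * IZR k) (h * (IZR k + 1))) -> forall a b, ex_RInt f a b.
Proof.
  intros hh hf a b.
  assert (hN : forall n, ex_RInt f (h * - INR n) (h * INR n)).
  { induction n as [|n IH].
    - simpl; rewrite Ropp_0; apply ex_RInt_point.
    - apply ex_RInt_Chasles with (h * - INR n).
      + assert (h1 := hf (- Z.of_nat (S n))%Z).
        rewrite opp_IZR, <- INR_IZR_INZ in h1.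
        replace (- INR (S n) + 1) with (- INR n) in h1 by (rewrite S_INR; ring). exact h1.
      + apply ex_RInt_Chasles with (h * INR n); [exact IH|].
        assert (h1 := hf (Z.of_nat n)). rewrite <- INR_IZR_INZ, <- S_INR in h1. exact h1. }
  assert (hc : forall c n, Rabs c <= h * INR n -> ex_RInt f (h * - INR n) c).
  { intros c n hc. apply Rabs_le_between in hc.
    apply (ex_RInt_Chasles_1 f) with (h * INR n); [lra|apply hN]. }
  destruct (nfloor_ex ((Rabs a + Rabs b) / h)) as [n hn].
  { apply Rle_mult_inv_pos; [|exact hh]. assert (h1 := Rabs_pos a); assert (h2 := Rabs_pos b); lra. }
  assert (hn2 : Rabs a + Rabs b < h * INR (S n)).
  { destruct hn as [_ hn]. apply Rlt_div_l in hn; [|exact hh]. rewrite S_INR; lra. }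
  assert (ha := Rabs_pos a). assert (hb := Rabs_pos b).
  apply ex_RInt_Chasles with (h * - INR (S n)); [apply ex_RInt_swap|]; apply hc; lra.
Qed.

(** Inside each cell [E_star] is the continuous function [I2] minus a constant, and values at the
    endpoints do not affect the Riemann integral. *)
Lemma ex_RInt_E_star (g psi : R -> R) (a b : R) : (forall x, continuous g x) ->
  (forall x, continuous psi x) -> ex_RInt (fun s => g (E_star s) * psi s) a b.
Proof.
  intros hg hpsi. assert (hpi := PI_RGT_0).
  apply (ex_RInt_cells _ (PI / 2)); [lra|]; intros k.
  destruct (divisor_steps_cell k) as [A hA].
  apply (ex_RInt_ext (fun s => g (I2 s - A) * psi s)).
  - intros s hs. rewrite Rmin_left, Rmax_right in hs by nra.
    now rewrite E_star_eq, (hA s hs).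
  - apply ex_RInt_cont; intros s.
    apply (continuous_mult (fun s => g (I2 s - A)) psi); [|apply hpsi].
    apply (continuous_comp (fun s => I2 s - A) g); [|apply hg].
    apply (continuous_minus I2 (fun _ => A)); [apply continuous_I2|apply continuous_const].
Qed.

Lemma is_RInt_shift (f : R -> R) (t a b l : R) :
  is_RInt f (t + a) (t + b) l -> is_RInt (fun u => f (t + u)) a b l.
Proof.
  intros h. apply (is_RInt_ext (fun y => scal 1 (f (1 * y + t)))).
  - intros x _. unfold scal; simpl; unfold mult; simpl.
    rewrite Rmult_1_l; f_equal; ring.
  - apply (is_RInt_comp_lin f).
    replace (1 * a + t) with (t + a) by ring. now replace (1 * b + t) with (t + b) by ring.
Qed.

Lemma ex_RInt_shift (f : R -> R) (t a b : R) :
  ex_RInt f (t + a) (t + b) -> ex_RInt (fun u => f (t + u)) a b.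
Proof. intros [l hl]; exists l; now apply is_RInt_shift. Qed.

Lemma ex_RInt_E_star_shift (g psi : R -> R) (t a b : R) : (forall x, continuous g x) ->
  (forall x, continuous psi x) -> ex_RInt (fun u => g (E_star (t + u)) * psi u) a b.
Proof.
  intros hg hpsi.
  apply (ex_RInt_ext (fun u => (fun s => g (E_star s) * psi (- t + s)) (t + u))).
  - intros x _; do 2 f_equal; ring.
  - apply (ex_RInt_shift (fun s => g (E_star s) * psi (- t + s))).
    apply (ex_RInt_E_star g (fun s => psi (- t + s))); [exact hg|].
    intros x; apply continuous_shift, hpsi.
Qed.

Lemma D_eq_sum (x : R) : D x = sum1 (fun k => INR (ndiv k)) (Z.to_nat (Int_part x)).
Proof.
  unfold D; generalize (Z.to_nat (Int_part x)); induction n as [|n IH]; [reflexivity|].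
  rewrite tech5, IH; reflexivity.
Qed.

(** In the bound, 1 pays for rounding the endpoints to integers, and exp (d ln x) lifts short
    intervals to the length from which the divisor estimate holds. *)
Lemma D_increment (d C : R) :
  (forall (N M : nat) (x y : R), exp 1 <= x -> INR (N + M) <= x -> INR M <= y ->
     exp (d * ln x) <= y -> sum1 (fun j => INR (ndiv (N + j))) M <= C * y * (ln x) ^ 2) ->
  forall X Y x, X <= Y -> exp 1 <= x -> Y <= x ->
  0 <= D Y - D X <= C * (Y - X + 1 + exp (d * ln x)) * (ln x) ^ 2.
Proof.
  intros hsum X Y x hXY hx hYx.
  rewrite !D_eq_sum.
  assert (hX := base_Int_part X). assert (hY := base_Int_part Y).
  assert (hx0 := exp_pos 1). assert (he := exp_pos (d * ln x)).
  set (N := Z.to_nat (Int_part X)). set (K := Z.to_nat (Int_part Y)).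
  assert (hXY' : (Int_part X <= Int_part Y)%Z).
  { assert (h : IZR (Int_part X) < IZR (Int_part Y + 1)) by (rewrite plus_IZR; lra).
    apply lt_IZR in h; lia. }
  assert (hNK : (N <= K)%nat) by (unfold N, K; lia).
  assert (hKx : INR K <= x).
  { unfold K. destruct (Z.le_gt_cases 0 (Int_part Y)) as [h|h].
    - rewrite INR_IZR_INZ, Z2Nat.id by assumption. lra.
    - replace (Z.to_nat (Int_part Y)) with 0%nat by lia. simpl; lra. }
  assert (hM : INR (K - N) <= Y - X + 1).
  { unfold K, N. destruct (Z.le_gt_cases 0 (Int_part Y)) as [h|h].
    - rewrite minus_INR by lia.
      rewrite !INR_IZR_INZ, (Z2Nat.id (Int_part Y)) by assumption.
      assert (h1 : IZR (Int_part X) <= IZR (Z.of_nat (Z.to_nat (Int_part X)))) by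
        (apply IZR_le; lia). lra.
    - replace (Z.to_nat (Int_part Y)) with 0%nat by lia. simpl; lra. }
  replace K with (N + (K - N))%nat by lia.
  rewrite <- (sum1_shift (fun k => INR (ndiv k))). split.
  - apply sum1_nonneg; intros; apply ndiv_nonneg.
  - apply hsum; [exact hx| |lra|lra].
    replace (N + (K - N))%nat with K by lia. exact hKx.
Qed.

Lemma divisor_steps_variation (eps c : R) : 0 < eps -> 0 < c -> exists C, 0 < C /\
  forall T G t u, 20 <= ln T -> 0 < T -> 1 <= G -> c * Rpower T eps <= G -> G <= T ->
  T <= t <= 2 * T -> Rabs u <= G * ln T ->
  Rabs (divisor_steps (t + u) - divisor_steps t) <= C * (Rabs u + G) * (ln T) ^ 2.
Proof.
  intros heps hc.
  (* The estimate is applied at x = T^3, where x^d <= T^eps <= G / c. *)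
  set (d := Rmin (eps / 3) 1).
  assert (hd : 0 < d <= 2).
  { unfold d; split; [apply Rmin_pos; lra|]. assert (h := Rmin_r (eps / 3) 1); lra. }
  destruct (ndiv_short_interval d hd) as (C & hC & hsum).
  assert (hci : 0 < / c) by (apply Rinv_0_lt_compat, hc).
  assert (hpi := PI_RGT_0).
  (* Here 63 = 2 * 7/2 * 9, with 7/2 the sum of the coefficients 1, 2, 1/2 and 9 from ln x = 3 ln
     T. *)
  exists (63 * PI * C * (2 + / c)); split.
  { apply Rmult_lt_0_compat; [apply Rmult_lt_0_compat|]; lra. }
  intros T G t u hL hT hG1 hG hGT ht hu.
  set (L := ln T) in *.
  assert (hTe : T = exp L) by (unfold L; now rewrite exp_ln).
  (* As |u| <= T ln T <= T^2, the power T^3 exceeds every argument of [D]. *)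
  set (x := exp (3 * L)).
  assert (hlx : ln x = 3 * L) by apply ln_exp.
  assert (hx1 : exp 1 <= x) by (apply exp_le_compat; lra).
  assert (hxT : x = T * (T * T)).
  { unfold x; rewrite hTe, <- !exp_plus; f_equal; ring. }
  assert (hLT : 1 + L <= T) by (rewrite hTe; apply exp_ineq1_le).
  assert (hxd : exp (d * ln x) <= / c * G).
  { rewrite hlx. apply Rle_trans with (Rpower T eps).
    - unfold Rpower; apply exp_le_compat. fold L.
      assert (h := Rmin_l (eps / 3) 1). fold d in h. nra.
    - apply (Rmult_le_reg_l c); [exact hc|]. rewrite <- Rmult_assoc, Rinv_r; lra. }
  assert (hu0 := Rabs_pos u).
  assert (hstep : forall a, 0 < a <= 4 ->
    Rabs (D (a * ((t + u) / (2 * PI))) - D (a * (t / (2 * PI)))) <=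
    C * ((2 + / c) * (Rabs u + G)) * (9 * L ^ 2)).
  { intros a ha.
    assert (hpi3 : 3 < PI) by (assert (h := PI2_3_2); lra).
    assert (hbound : forall s, Rabs s <= 3 * T * T -> a * (s / (2 * PI)) <= x).
    { intros s hs. apply Rle_trans with (Rabs s).
      - apply Rle_trans with (1 * Rabs s); [|lra].
        replace (a * (s / (2 * PI))) with ((a / (2 * PI)) * s) by (field; lra).
        assert (ha1 : 0 < a / (2 * PI) <= 1).
        { split; [apply Rdiv_lt_0_compat; lra|apply Rle_div_l; lra]. }
        assert (h1 := Rle_abs s). assert (h2 := Rabs_pos s). nra.
      - rewrite hxT. nra. }
    assert (htu : Rabs (t + u) <= 3 * T * T).
    { eapply Rle_trans; [apply Rabs_triang|]. rewrite (Rabs_right t) by lra. nra. }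
    assert (ht' : Rabs t <= 3 * T * T) by (rewrite Rabs_right; nra).
    assert (hdiff : Rabs (a * ((t + u) / (2 * PI)) - a * (t / (2 * PI))) <= Rabs u).
    { replace (a * ((t + u) / (2 * PI)) - a * (t / (2 * PI))) with ((a / (2 * PI)) * u)
        by (field; lra).
      rewrite Rabs_mult, (Rabs_right (a / (2 * PI))) by
        (apply Rle_ge, Rlt_le, Rdiv_lt_0_compat; lra).
      assert (a / (2 * PI) <= 1) by (apply Rle_div_l; lra). nra. }
    assert (hfin : forall w, w <= Rabs u ->
      C * (w + 1 + exp (d * ln x)) * ln x ^ 2 <=
      C * ((2 + / c) * (Rabs u + G)) * (9 * L ^ 2)).
    { intros w hw. rewrite hlx. replace ((3 * L) ^ 2) with (9 * L ^ 2) by ring.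
      apply Rmult_le_compat_r; [nra|]. apply Rmult_le_compat_l; [lra|].
      rewrite hlx in hxd. nra. }
    assert (h1 := hbound _ htu). assert (h2 := hbound _ ht').
    apply Rabs_le_between in hdiff.
    set (Y := a * ((t + u) / (2 * PI))) in *. set (X := a * (t / (2 * PI))) in *.
    destruct (Rle_lt_dec X Y) as [hXY|hXY].
    - assert (h := D_increment d C hsum X Y x hXY hx1 h1).
      rewrite Rabs_right by lra. eapply Rle_trans; [apply h|]. apply hfin; lra.
    - assert (h := D_increment d C hsum Y X x ltac:(lra) hx1 h2).
      rewrite Rabs_left1 by lra.
      apply Rle_trans with (D X - D Y); [lra|].
      eapply Rle_trans; [apply h|]. apply hfin; lra. }
  unfold divisor_steps.
  assert (h1 := hstep 1 ltac:(lra)). assert (h2 := hstep 2 ltac:(lra)).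
  assert (h4 := hstep 4 ltac:(lra)). rewrite !Rmult_1_l in h1.
  set (W := C * ((2 + / c) * (Rabs u + G)) * (9 * L ^ 2)) in *.
  apply Rabs_le_between in h1. apply Rabs_le_between in h2. apply Rabs_le_between in h4.
  replace (63 * PI * C * (2 + / c) * (Rabs u + G) * L ^ 2) with (2 * PI * (7 / 2 * W))
    by (unfold W; field; lra).
  rewrite <- Rmult_minus_distr_l, Rabs_mult, (Rabs_right (2 * PI)) by lra.
  apply Rmult_le_compat_l; [lra|]. apply Rabs_le_between; lra.
Qed.

(** * Integrals and real powers *)

Lemma RInt_plus_R (f g : R -> R) (a b : R) : ex_RInt f a b -> ex_RInt g a b ->
  RInt (fun x => f x + g x) a b = RInt f a b + RInt g a b.
Proof. exact (RInt_plus f g a b). Qed.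

Lemma RInt_minus_R (f g : R -> R) (a b : R) : ex_RInt f a b -> ex_RInt g a b ->
  RInt (fun x => f x - g x) a b = RInt f a b - RInt g a b.
Proof. exact (RInt_minus f g a b). Qed.

Lemma RInt_scal_R (c : R) (f : R -> R) (a b : R) : ex_RInt f a b ->
  RInt (fun x => c * f x) a b = c * RInt f a b.
Proof. exact (RInt_scal f a b c). Qed.

Lemma ex_RInt_plus_R (f g : R -> R) (a b : R) : ex_RInt f a b -> ex_RInt g a b ->
  ex_RInt (fun x => f x + g x) a b.
Proof. exact (ex_RInt_plus f g a b). Qed.

Lemma ex_RInt_scal_R (c : R) (f : R -> R) (a b : R) : ex_RInt f a b ->
  ex_RInt (fun x => c * f x) a b.
Proof. exact (ex_RInt_scal f a b c). Qed.

Lemma RInt_const_R (a b c : R) : RInt (fun _ => c) a b = (b - a) * c.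
Proof. exact (RInt_const a b c). Qed.

Lemma ex_RInt_const_R (a b c : R) : ex_RInt (fun _ => c) a b.
Proof. exact (ex_RInt_const a b c). Qed.

(** * Integrals over shifted windows *)

Lemma RInt_shift_primitive (f : R -> R) (t a b : R) : (forall x y, ex_RInt f x y) ->
  RInt (fun u => f (t + u)) a b = RInt f 0 (t + b) - RInt f 0 (t + a).
Proof.
  intros h. apply is_RInt_unique, is_RInt_shift.
  replace (RInt f 0 (t + b) - RInt f 0 (t + a)) with (RInt f (t + a) (t + b));
    [apply (RInt_correct f), h|].
  assert (e := RInt_Chasles f 0 (t + a) (t + b) (h _ _) (h _ _)).
  change (RInt f 0 (t + a) + RInt f (t + a) (t + b) = RInt f 0 (t + b)) in e. lra.
Qed.

Lemma continuous_primitive (f : R -> R) (x : R) : (forall a b, ex_RInt f a b) ->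
  continuous (fun x => RInt f 0 x) x.
Proof.
  intros h; apply (continuous_RInt_1 f 0 x).
  apply filter_forall; intros y; apply (RInt_correct f), h.
Qed.

(** The function f may jump, as [E_star] does; its window integral is a difference of shifted
    primitives and thus continuous. *)
Lemma continuous_window (f : R -> R) (c d t : R) : (forall a b, ex_RInt f a b) ->
  continuous (fun t => RInt (fun u => f (t + u)) c d) t.
Proof.
  intros h.
  apply (continuous_ext (fun t => RInt f 0 (d + t) - RInt f 0 (c + t))).
  - intros s; rewrite RInt_shift_primitive by assumption.
    now rewrite (Rplus_comm d), (Rplus_comm c).
  - apply (continuous_minus (fun t => RInt f 0 (d + t)) (fun t => RInt f 0 (c + t)));
      apply (continuous_shift (fun x => RInt f 0 x)); intros; now apply continuous_primitive.
Qed.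

(* Both sides are second differences of a twofold primitive of [f]. *)
Lemma RInt_window_swap (f : R -> R) (a b c d : R) : (forall x y, ex_RInt f x y) ->
  RInt (fun t => RInt (fun u => f (t + u)) c d) a b =
  RInt (fun u => RInt (fun t => f (t + u)) a b) c d.
Proof.
  intros h.
  set (F := fun x => RInt f 0 x).
  assert (hF : forall x y, ex_RInt F x y).
  { intros; apply ex_RInt_cont; intros; now apply continuous_primitive. }
  assert (key : forall a b c d, RInt (fun t => RInt (fun u => f (t + u)) c d) a b =
    (RInt F 0 (d + b) - RInt F 0 (d + a)) - (RInt F 0 (c + b) - RInt F 0 (c + a))).
  { clear a b c d; intros a b c d.
    rewrite (RInt_ext _ (fun t => F (d + t) - F (c + t))).
    - rewrite (RInt_minus_R (fun t => F (d + t)) (fun t => F (c + t)));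
        [|apply (ex_RInt_shift F), hF|apply (ex_RInt_shift F), hF].
      rewrite !RInt_shift_primitive by assumption. reflexivity.
    - intros t _. rewrite RInt_shift_primitive by assumption.
      unfold F; now rewrite (Rplus_comm d), (Rplus_comm c). }
  rewrite key.
  rewrite (RInt_ext (fun u => RInt (fun t => f (t + u)) a b)
    (fun u => RInt (fun t => f (u + t)) a b)).
  - rewrite key, (Rplus_comm d b), (Rplus_comm d a), (Rplus_comm c b), (Rplus_comm c a).
    match goal with |- _ ?x ?y => change (x = y :> R) end. ring.
  - intros u _; apply RInt_ext; intros t _; f_equal; ring.
Qed.

(** * Real powers and Jensen's inequality *)

Lemma rpow_pos (x m : R) : 0 < x -> rpow x m = Rpower x m.
Proof. intros h; unfold rpow; destruct (Req_EM_T x 0); [lra|reflexivity]. Qed.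

Lemma rpow_0 (m : R) : rpow 0 m = 0.
Proof. unfold rpow; destruct (Req_EM_T 0 0); [reflexivity|lra]. Qed.

Lemma rpow_nonneg (x m : R) : 0 <= rpow x m.
Proof. unfold rpow; destruct (Req_EM_T x 0); [lra|apply Rlt_le, exp_pos]. Qed.

Lemma rpow_mono (x y m : R) : 1 <= m -> 0 <= x <= y -> rpow x m <= rpow y m.
Proof.
  intros hm [hx hxy]. destruct hx as [hx|hx].
  - rewrite !rpow_pos by lra. apply exp_le_compat.
    assert (ln x <= ln y) by (now apply ln_le). nra.
  - subst x; rewrite rpow_0; apply rpow_nonneg.
Qed.

Lemma rpow_mult_pos (c x m : R) : 0 < c -> 0 <= x -> rpow (c * x) m = Rpower c m * rpow x m.
Proof.
  intros hc [hx|hx].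
  - rewrite !rpow_pos by (assumption || now apply Rmult_lt_0_compat).
    symmetry; apply Rpower_mult_distr; assumption.
  - subst x; rewrite Rmult_0_r, !rpow_0; ring.
Qed.

Lemma rpow_plus_le (x y m : R) : 1 <= m -> 0 <= x -> 0 <= y ->
  rpow (x + y) m <= Rpower 2 m * (rpow x m + rpow y m).
Proof.
  intros hm hx hy.
  assert (h := exp_pos (m * ln 2)). fold (Rpower 2 m) in h.
  assert (h1 := rpow_nonneg x m). assert (h2 := rpow_nonneg y m).
  destruct (Rle_lt_dec x y) as [hxy|hxy].
  - apply Rle_trans with (rpow (2 * y) m); [apply rpow_mono; lra|].
    rewrite rpow_mult_pos by lra. nra.
  - apply Rle_trans with (rpow (2 * x) m); [apply rpow_mono; lra|].
    rewrite rpow_mult_pos by lra. nra.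
Qed.

(** Bernoulli's inequality y^m >= 1 + m (y - 1) at y = exp x, from exp ((m-1) x) >= 1 + (m-1) x and
    exp x (1 - x) <= 1. *)
Lemma exp_bernoulli (m x : R) : 1 <= m -> 1 + m * (exp x - 1) <= exp (m * x).
Proof.
  intros hm.
  assert (h1 : exp (m * x) = exp x * exp ((m - 1) * x)) by (rewrite <- exp_plus; f_equal; ring).
  assert (h2 := exp_ineq1_le ((m - 1) * x)).
  assert (h3 := exp_ineq1_le (- x)).
  assert (h4 : exp x * exp (- x) = 1) by (rewrite <- exp_plus, Rplus_opp_r; apply exp_0).
  assert (h5 := exp_pos x). rewrite h1.
  apply Rle_trans with (exp x * (1 + (m - 1) * x)); [|apply Rmult_le_compat_l; lra].
  assert (h6 : exp x * (1 - x) <= 1) by nra. nra.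
Qed.

(** The power function lies above its tangent at a: Bernoulli's inequality at y / a, scaled by
    a^m. *)
Lemma rpow_tangent (m a y : R) : 1 <= m -> 0 < a -> 0 <= y ->
  rpow a m + m * rpow a m / a * (y - a) <= rpow y m.
Proof.
  intros hm ha hy.
  rewrite (rpow_pos a) by assumption.
  assert (hA : 0 < Rpower a m) by apply exp_pos.
  replace (Rpower a m + m * Rpower a m / a * (y - a)) with
    (Rpower a m * (1 + m * (y / a - 1))) by (field; lra).
  destruct hy as [hy|hy].
  - rewrite rpow_pos by assumption.
    assert (hya : 0 < y / a) by (apply Rdiv_lt_0_compat; assumption).
    replace (Rpower y m) with (Rpower a m * Rpower (y / a) m).
    2:{ rewrite Rpower_mult_distr by assumption. f_equal; field; lra. }
    apply Rmult_le_compat_l; [lra|].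
    assert (h := exp_bernoulli m (ln (y / a)) hm). rewrite exp_ln in h by assumption. exact h.
  - subst y; rewrite rpow_0. unfold Rdiv; rewrite Rmult_0_l. nra.
Qed.

Lemma continuous_rpow_abs (m x : R) : 1 <= m -> continuous (fun x => rpow (Rabs x) m) x.
Proof.
  intros hm. destruct (Req_dec x 0) as [e|e].
  - subst x; apply continuity_pt_filterlim; intros eps heps.
    (* For |x| < 1 and m >= 1, |x|^m <= |x|. *)
    exists (Rmin eps 1); split; [apply Rmin_pos; lra|].
    intros x [_ hd]. simpl in hd |- *. unfold Rdist in hd |- *.
    rewrite Rminus_0_r in hd.
    assert (hd1 := Rlt_le_trans _ _ _ hd (Rmin_l _ _)).
    assert (hd2 := Rlt_le_trans _ _ _ hd (Rmin_r _ _)).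
    rewrite Rabs_R0, rpow_0, Rminus_0_r, Rabs_right by apply Rle_ge, rpow_nonneg.
    eapply Rle_lt_trans; [|exact hd1].
    destruct (Rabs_pos x) as [hx|hx].
    + rewrite rpow_pos by assumption. rewrite <- (exp_ln (Rabs x)) at 2 by assumption.
      apply exp_le_compat.
      assert (ln (Rabs x) < 0) by (rewrite <- ln_1; now apply ln_increasing). nra.
    + rewrite <- hx, rpow_0; lra.
  - assert (hx : 0 < Rabs x) by now apply Rabs_pos_lt.
    apply (continuous_ext_loc _ (fun x => exp (m * ln (Rabs x)))).

    + exists (mkposreal _ hx); intros y hy.
      change (Rabs (y - x) < Rabs x) in hy.
      symmetry; apply rpow_pos. apply Rabs_pos_lt; intros e1; subst y.
      rewrite Rminus_0_l, Rabs_Ropp in hy; lra.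
    + apply (continuous_comp Rabs (fun y => exp (m * ln y))); [apply continuous_Rabs|].
      apply (ex_derive_continuous (fun y => exp (m * ln y))). auto_derive. exact hx.
Qed.

(** The tangent at the weighted mean X / M is integrated against k. The weight has mass M instead of
    1, whence the factor M^(m-1). *)
Lemma jensen_rpow (f k : R -> R) (m a b : R) : 1 <= m -> a <= b ->
  (forall x, 0 <= f x) -> (forall x, 0 <= k x) -> ex_RInt k a b -> 0 < RInt k a b ->
  ex_RInt (fun x => f x * k x) a b -> ex_RInt (fun x => rpow (f x) m * k x) a b ->
  rpow (RInt (fun x => f x * k x) a b) m <=
  Rpower (RInt k a b) (m - 1) * RInt (fun x => rpow (f x) m * k x) a b.
Proof.
  intros hm hab hf hk exk hM exfk exmk.
  set (M := RInt k a b) in *. set (X := RInt (fun x => f x * k x) a b).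
  set (P := RInt (fun x => rpow (f x) m * k x) a b).
  assert (hX : 0 <= X).
  { apply RInt_ge_0; [exact hab|exact exfk|intros; now apply Rmult_le_pos]. }
  assert (hP : 0 <= P).
  { apply RInt_ge_0; [exact hab|exact exmk|].
    intros; apply Rmult_le_pos; [apply rpow_nonneg|apply hk]. }
  assert (hMp : 0 < Rpower M (m - 1)) by apply exp_pos.
  destruct hX as [hX|hX]; [|rewrite <- hX, rpow_0; apply Rmult_le_pos; lra].
  set (y := X / M).
  assert (hy : 0 < y) by (apply Rdiv_lt_0_compat; assumption).
  set (c := m * rpow y m / y).
  assert (h : rpow y m * M <= P).
  { apply Rle_trans with (RInt (fun x => (rpow y m - c * y) * k x + c * (f x * k x)) a b).
    - rewrite (RInt_plus_R (fun x => (rpow y m - c * y) * k x) (fun x => c * (f x * k x)));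
        try now apply ex_RInt_scal_R.
      rewrite !RInt_scal_R by assumption. fold M X.
      replace X with (y * M) by (unfold y; field; lra). right; ring.
    - apply RInt_le; [exact hab|apply ex_RInt_plus_R; now apply ex_RInt_scal_R|exact exmk|].
      intros x _. assert (h := rpow_tangent m y (f x) hm hy (hf x)). fold c in h.
      specialize (hk x). nra. }
  apply Rle_trans with (Rpower M (m - 1) * (rpow y m * M)); [|apply Rmult_le_compat_l; lra].
  replace X with (M * y) by (unfold y; field; lra).
  rewrite rpow_mult_pos by lra.
  replace (Rpower M m) with (Rpower M (m - 1) * M); [right; ring|].
  rewrite <- (Rpower_1 M) at 2 by assumption. rewrite <- Rpower_plus; f_equal; ring.
Qed.

(** * The derivative of the Gaussian and its Cauchy majorant *)

Definition gauss_kernel (G u : R) : R := 2 * u / G ^ 2 * gauss G u.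
Definition cauchy_kernel (G u : R) : R := / (1 + (u / G) ^ 2).

Lemma is_derive_gauss (G u : R) : 0 < G -> is_derive (gauss G) u (- gauss_kernel G u).
Proof.
  intros hG; unfold gauss_kernel, gauss. auto_derive; [exact I|].
  replace (u * / G * (u * / G * 1)) with ((u / G) ^ 2) by (field; lra). field; lra.
Qed.

Lemma continuous_gauss_kernel (G u : R) : continuous (gauss_kernel G) u.
Proof.
  apply (continuous_mult (fun u => 2 * u / G ^ 2) (gauss G)); [|apply continuous_gauss].
  apply (ex_derive_continuous (fun u => 2 * u / G ^ 2)); auto_derive; exact I.
Qed.

Lemma RInt_gauss_kernel (G V : R) : 0 < G -> RInt (gauss_kernel G) (- V) V = 0.
Proof.
  intros hG. apply is_RInt_unique.
  replace 0 with (minus (- gauss G V) (- gauss G (- V))).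
  - apply (is_RInt_derive (fun u => - gauss G u)).
    + intros x _. rewrite <- (Ropp_involutive (gauss_kernel G x)).
      apply (is_derive_opp (gauss G)), is_derive_gauss, hG.
    + intros; apply continuous_gauss_kernel.
  - rewrite gauss_even. unfold minus, plus, opp; simpl; ring.
Qed.

Lemma smoothed_by_parts (G t V : R) : 0 < G ->
  RInt (fun u => Z2 (t + u) * gauss G u) (- V) V =
  (I2 (t + V) - I2 (t + - V)) * gauss G V +
  RInt (fun u => I2 (t + u) * gauss_kernel G u) (- V) V.
Proof.
  intros hG.
  assert (hc1 : forall u, continuous (fun u => I2 (t + u) * gauss_kernel G u) u).
  { intros u; apply (continuous_mult (fun u => I2 (t + u)) (gauss_kernel G));
      [apply continuous_shift, continuous_I2|apply continuous_gauss_kernel]. }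
  assert (hc2 : forall u, continuous (fun u => Z2 (t + u) * gauss G u) u) by
    (intros; apply continuous_smoothed).
  assert (h : RInt (fun u => Z2 (t + u) * gauss G u - I2 (t + u) * gauss_kernel G u) (- V) V =
    I2 (t + V) * gauss G V - I2 (t + - V) * gauss G (- V)).
  { apply is_RInt_unique.
    apply (is_RInt_derive (fun u => I2 (t + u) * gauss G u)).
    - intros u _.
      replace (Z2 (t + u) * gauss G u - I2 (t + u) * gauss_kernel G u) with
        (Z2 (t + u) * gauss G u + I2 (t + u) * - gauss_kernel G u) by ring.
      apply (is_derive_mult (fun u => I2 (t + u)) (gauss G)).
      + replace (Z2 (t + u)) with (scal 1 (Z2 (t + u))) by
          (unfold scal; simpl; unfold mult; simpl; ring).
        apply (is_derive_comp I2 (fun u => t + u)); [apply is_derive_I2|].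
        auto_derive; [exact I|ring].
      + now apply is_derive_gauss.
      + intros; apply Rmult_comm.
    - intros u _. apply (continuous_minus (fun u => Z2 (t + u) * gauss G u)
        (fun u => I2 (t + u) * gauss_kernel G u)); [apply hc2|apply hc1]. }
  rewrite RInt_minus_R, gauss_even in h by now apply ex_RInt_cont. lra.
Qed.

Lemma I2_bound (s : R) : Rabs (I2 s) <= 80 * (1 + Rabs s) ^ 3.
Proof.
  assert (hs := Rabs_pos s). assert (h2 := pow2_ge_0 (1 + Rabs s)).
  assert (h : Rabs (I2 s) <= Rabs s * (80 * (1 + Rabs s) ^ 2)).
  { assert (hz : forall x, Rabs x <= Rabs s -> Rabs (Z2 x) <= 80 * (1 + Rabs s) ^ 2).
    { intros x hx. rewrite Rabs_right by apply Rle_ge, Z2_nonneg.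
      eapply Rle_trans; [apply Z2_bound|]. apply Rmult_le_compat_l; [lra|].
      apply pow_incr. assert (h := Rabs_pos x); lra. }
    assert (hex : forall a b, ex_RInt Z2 a b) by
      (intros; apply ex_RInt_cont, continuous_Z2).
    set (M := 80 * (1 + Rabs s) ^ 2) in *.
    unfold I2. destruct (Rle_lt_dec 0 s) as [h|h].
    - replace (Rabs s) with (s - 0) by (rewrite Rabs_right; lra).
      apply abs_RInt_le_const; [exact h|apply hex|].
      intros x hx; apply hz. rewrite !Rabs_right; lra.
    - assert (e := opp_RInt_swap Z2 s 0 (hex _ _)).
      change (- RInt Z2 s 0 = RInt Z2 0 s) in e. rewrite <- e, Rabs_Ropp.
      replace (Rabs s) with (0 - s) by (rewrite Rabs_left; lra).
      apply abs_RInt_le_const; [lra|apply hex|].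
      intros x hx; apply hz. rewrite !Rabs_left1; lra. }
  eapply Rle_trans; [exact h|]. simpl pow in *. nra.
Qed.

Lemma cauchy_kernel_pos (G u : R) : 0 < cauchy_kernel G u <= 1.
Proof.
  unfold cauchy_kernel. assert (h := pow2_ge_0 (u / G)).
  split; [apply Rinv_0_lt_compat; lra|].
  rewrite <- Rinv_1 at 2. apply Rinv_le_contravar; lra.
Qed.

Lemma continuous_cauchy_kernel (G u : R) : continuous (cauchy_kernel G) u.
Proof.
  unfold cauchy_kernel. apply (ex_derive_continuous (fun u => / (1 + (u / G) ^ 2))).
  auto_derive. assert (h := pow2_ge_0 (u / G)). unfold Rdiv in h; simpl in h. lra.
Qed.

Lemma RInt_cauchy_kernel (G V : R) : 0 < G -> 0 < V ->
  0 < RInt (cauchy_kernel G) (- V) V <= 4 * G.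
Proof.
  intros hG hV.
  assert (e : RInt (cauchy_kernel G) (- V) V = G * atan (V / G) - G * atan (- V / G)).
  { apply is_RInt_unique. apply (is_RInt_derive (fun u => G * atan (u / G))).
    - intros u _; unfold cauchy_kernel. auto_derive; [exact I|].
      assert (h := pow2_ge_0 (u / G)). unfold Rsqr, Rdiv in *. simpl in *. field.
      split; [lra|]. assert (0 < G * G) by nra. assert (h1 := pow2_ge_0 u). nra.
    - intros; apply continuous_cauchy_kernel. }
  rewrite e. replace (- V / G) with (- (V / G)) by (unfold Rdiv; ring). rewrite atan_opp.
  assert (h1 := atan_bound (V / G)). assert (h2 := PI_4).
  assert (h3 : 0 < atan (V / G)).
  { rewrite <- atan_0; apply atan_increasing, Rdiv_lt_0_compat; assumption. }
  nra.
Qed.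

Lemma gauss_cauchy_bound (G u : R) : 0 < G ->
  (1 + (u / G) ^ 2) * gauss G u <= 4 * cauchy_kernel G u.
Proof.
  intros hG; unfold gauss, cauchy_kernel. set (s := (u / G) ^ 2).
  assert (hs : 0 <= s) by apply pow2_ge_0.
  assert (h : (1 + s) * (1 + s) <= 4 * exp s).
  { assert (h := exp_ineq1_le (s / 2)).
    assert (e : exp s = exp (s / 2) * exp (s / 2)) by (rewrite <- exp_plus; f_equal; field).
    rewrite e; nra. }
  rewrite exp_Ropp. assert (h1 := exp_pos s).
  apply (Rmult_le_reg_r (exp s * (1 + s))); [nra|].
  replace ((1 + s) * / exp s * (exp s * (1 + s))) with ((1 + s) * (1 + s)) by (field; lra).
  replace (4 * / (1 + s) * (exp s * (1 + s))) with (4 * exp s) by (field; lra). exact h.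
Qed.

Lemma gauss_kernel_abs (G u : R) : 0 < G ->
  Rabs (gauss_kernel G u) = 2 * (Rabs u / G) / G * gauss G u.
Proof.
  intros hG; unfold gauss_kernel. assert (h := gauss_pos G u).
  rewrite Rabs_mult, (Rabs_right (gauss G u)) by lra. f_equal.
  replace (2 * u / G ^ 2) with (2 / G ^ 2 * u) by (field; lra).
  rewrite Rabs_mult, (Rabs_right (2 / G ^ 2)); [field; lra|].
  apply Rle_ge, Rlt_le, Rdiv_lt_0_compat; nra.
Qed.

(** The first bound serves the [E_star] part, the second the variation of A, which grows like |u| +
    G. With y = |u| / G, 2 y <= 1 + y^2 reduces both to [gauss_cauchy_bound]. *)
Lemma gauss_kernel_bound (G u : R) : 0 < G ->
  Rabs (gauss_kernel G u) <= 4 / G * cauchy_kernel G u /\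
  (Rabs u + G) * Rabs (gauss_kernel G u) <= 12 * cauchy_kernel G u.
Proof.
  intros hG. rewrite gauss_kernel_abs by assumption.
  assert (h := gauss_cauchy_bound G u hG). assert (hg := gauss_pos G u).
  assert (hs : (u / G) ^ 2 = (Rabs u / G) ^ 2).
  { rewrite <- (pow2_abs (u / G)); f_equal. unfold Rdiv; rewrite Rabs_mult.
    now rewrite (Rabs_right (/ G)) by (apply Rle_ge, Rlt_le, Rinv_0_lt_compat, hG). }
  rewrite hs in h. set (y := Rabs u / G) in *.
  assert (hy : 0 <= y) by (apply Rle_mult_inv_pos; [apply Rabs_pos|exact hG]).
  assert (hu : Rabs u = G * y) by (unfold y; field; lra).
  set (g := gauss G u) in *. set (k := cauchy_kernel G u) in *.
  assert (hy2 := pow2_ge_0 (y - 1)).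
  split.
  - replace (2 * y / G * g) with (/ G * (2 * y * g)) by (field; lra).
    replace (4 / G * k) with (/ G * (4 * k)) by (field; lra).
    apply Rmult_le_compat_l; [apply Rlt_le, Rinv_0_lt_compat, hG|]. nra.
  - rewrite hu. replace ((G * y + G) * (2 * y / G * g)) with ((2 * y * y + 2 * y) * g)
      by (field; lra). nra.
Qed.

(** For y = |u| / G >= ln T, exp (-y^2) splits into exp (-(ln T - 1) y) exp (-y), and the last
    factor absorbs the growth of [Z2]. The decay rate grows with ln T, so the tail beyond G ln T
    outweighs the factor T^2. The constant is 160 (9 + 4). *)
Lemma smoothed_tail_fine (T G t u : R) : 1 <= T -> 1 <= ln T -> 0 < G -> G <= T ->
  Rabs t <= 2 * T -> G * ln T <= Rabs u ->
  Z2 (t + u) * gauss G u <= 2080 * T ^ 2 * exp (- ((ln T - 1) / G * Rabs u)).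
Proof.
  intros hT hL hG hGT ht hu.
  assert (h1 := Z2_shift_bound (2 * T) t u ht). rewrite gauss_abs by assumption.
  set (L := ln T) in *. set (y := Rabs u / G).
  assert (hy : L <= y) by (unfold y; apply Rle_div_r; lra).
  assert (hu2 : Rabs u = G * y) by (unfold y; field; lra).
  rewrite hu2 in *. replace ((L - 1) / G * (G * y)) with ((L - 1) * y) by (field; lra).
  assert (h2 : exp (- y ^ 2) <= exp (- ((L - 1) * y)) * exp (- y)).
  { rewrite <- exp_plus; apply exp_le_compat. nra. }
  assert (h3 := sq_le_4_exp y ltac:(lra)).
  assert (h4 : exp y * exp (- y) = 1) by (rewrite <- exp_plus, Rplus_opp_r; apply exp_0).
  assert (h5 := exp_pos (- y)). assert (h6 := exp_ineq1_le y).
  assert (h7 : Z2 (t + u) <= 2080 * T ^ 2 * exp y).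
  { eapply Rle_trans; [exact h1|].
    assert ((1 + 2 * T) ^ 2 <= 9 * T ^ 2) by nra.
    assert ((G * y) ^ 2 <= T ^ 2 * y ^ 2) by
      (rewrite Rpow_mult_distr; apply Rmult_le_compat_r; [apply pow2_ge_0|apply pow_incr; lra]).
    assert (hT2 : 0 <= T ^ 2) by apply pow2_ge_0.
    assert (T ^ 2 * y ^ 2 <= T ^ 2 * (4 * exp y)) by (apply Rmult_le_compat_l; assumption).
    assert (T ^ 2 * 1 <= T ^ 2 * exp y) by (apply Rmult_le_compat_l; lra). lra. }
  apply Rle_trans with (2080 * T ^ 2 * exp y * (exp (- ((L - 1) * y)) * exp (- y))).
  - apply Rmult_le_compat; [apply Z2_nonneg|apply Rlt_le, exp_pos|exact h7|exact h2].
  - right. transitivity (2080 * T ^ 2 * exp (- ((L - 1) * y)) * (exp y * exp (- y))); [ring|].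
    rewrite h4; ring.
Qed.

Lemma J1_pointwise (eps c : R) : 0 < eps -> 0 < c -> exists C, 0 < C /\
  forall T G t, 20 <= ln T -> 0 < T -> 1 <= G -> c * Rpower T eps <= G -> G <= T ->
  T <= t <= 2 * T ->
  J1 t G <= 4 / G ^ 2 *
    RInt (fun u => Rabs (E_star (t + u)) * cauchy_kernel G u) (- (G * ln T)) (G * ln T)
    + C * (ln T) ^ 2.
Proof.
  intros heps hc.
  destruct (divisor_steps_variation eps c heps hc) as (C & hC & hvar).
  (* 8480 = 4160 + 4320 collects the tail and the boundary term; 48 = 12 * 4 uses the mass 4 G of
     the Cauchy kernel. *)
  exists (8480 + 48 * C); split; [lra|].
  intros T G t hL hT hG1 hG hGT ht.
  set (L := ln T) in *. set (V := G * L).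
  assert (hTe : T = exp L) by (unfold L; now rewrite exp_ln).
  assert (hLT : 1 + L <= T) by (rewrite hTe; apply exp_ineq1_le).
  assert (hV : 0 < V) by (unfold V; nra).
  assert (ht0 : Rabs t <= 2 * T) by (rewrite Rabs_right; lra).
  set (X := RInt (fun u => Rabs (E_star (t + u)) * cauchy_kernel G u) (- V) V).
  assert (hs := smoothed_bounds G t V (2080 * T ^ 2) ((L - 1) / G) ltac:(lra)
    ltac:(apply Rdiv_lt_0_compat; lra) ltac:(assert (h := pow2_ge_0 T); lra)
    (fun u hu => smoothed_tail_fine T G t u ltac:(lra) ltac:(fold L; lra) ltac:(lra) hGT ht0 hu)).
  cbv zeta in hs. destruct hs as [_ hs].
  assert (htail : 2 * (2080 * T ^ 2 / ((L - 1) / G) * exp (- ((L - 1) / G * V))) <= 4160 * G).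
  { replace ((L - 1) / G * V) with ((L - 1) * L) by (unfold V; field; lra).
    assert (h1 : T ^ 2 * exp (- ((L - 1) * L)) <= 1).
    { replace (T ^ 2) with (exp (L + L)) by (rewrite exp_plus, <- hTe; ring).
      rewrite <- exp_plus. apply Rle_trans with (exp 0); [|rewrite exp_0; lra].
      apply exp_le_compat. nra. }
    replace (2 * (2080 * T ^ 2 / ((L - 1) / G) * exp (- ((L - 1) * L)))) with
      (4160 * G * (T ^ 2 * exp (- ((L - 1) * L)) * / (L - 1))) by (field; lra).
    assert (h2 : 0 < / (L - 1) <= 1).
    { split; [apply Rinv_0_lt_compat; lra|]. rewrite <- Rinv_1 at 2.
      apply Rinv_le_contravar; lra. }
    assert (h3 : 0 <= T ^ 2 * exp (- ((L - 1) * L))) by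
      (apply Rmult_le_pos; [apply pow2_ge_0|apply Rlt_le, exp_pos]).
    rewrite <- (Rmult_1_r (4160 * G)) at 2.
    apply Rmult_le_compat_l; [lra|]. nra. }
  rewrite smoothed_by_parts in hs by lra.
  assert (hbd : (I2 (t + V) - I2 (t + - V)) * gauss G V <= 4320 * G).
  { assert (hI : forall v, Rabs v <= V -> Rabs (I2 (t + v)) <= 2160 * T ^ 6).
    { intros v hv. eapply Rle_trans; [apply I2_bound|].
      assert (h1 : 0 <= 1 + Rabs (t + v) <= 3 * (T * T)).
      { split; [assert (h := Rabs_pos (t + v)); lra|].
        assert (h := Rabs_triang t v). assert (V <= T * L) by (unfold V; nra). nra. }
      apply Rle_trans with (80 * (3 * (T * T)) ^ 3); [|right; ring].
      apply Rmult_le_compat_l; [lra|]. apply pow_incr; lra. }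
    assert (h1 := hI V ltac:(rewrite Rabs_right; lra)).
    assert (h2 := hI (- V) ltac:(rewrite Rabs_Ropp, Rabs_right; lra)).
    apply Rabs_le_between in h1. apply Rabs_le_between in h2.
    assert (hg := gauss_pos G V).
    assert (hg2 : T ^ 6 * gauss G V <= 1).
    { unfold gauss. replace (V / G) with L by (unfold V; field; lra).
      replace (T ^ 6) with (exp (L + L + L + L + L + L)) by (rewrite !exp_plus, <- hTe; ring).
      rewrite <- exp_plus. apply Rle_trans with (exp 0); [|rewrite exp_0; lra].
      apply exp_le_compat. nra. }
    apply Rle_trans with (4320 * T ^ 6 * gauss G V); [|lra].
    apply Rmult_le_compat_r; lra. }
  assert (exE : ex_RInt (fun u => Rabs (E_star (t + u)) * cauchy_kernel G u) (- V) V).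
  { apply (ex_RInt_E_star_shift Rabs (cauchy_kernel G));
      [apply continuous_Rabs|apply continuous_cauchy_kernel]. }
  assert (exK : ex_RInt (cauchy_kernel G) (- V) V) by
    (apply ex_RInt_cont, continuous_cauchy_kernel).
  assert (exI : ex_RInt (fun u => I2 (t + u) * gauss_kernel G u) (- V) V).
  { apply ex_RInt_cont; intros u.
    apply (continuous_mult (fun u => I2 (t + u)) (gauss_kernel G));
      [apply continuous_shift, continuous_I2|apply continuous_gauss_kernel]. }
  assert (exg : ex_RInt (gauss_kernel G) (- V) V) by
    (apply ex_RInt_cont, continuous_gauss_kernel).
  assert (hmain : RInt (fun u => I2 (t + u) * gauss_kernel G u) (- V) V <=
    4 / G * X + 12 * C * L ^ 2 * RInt (cauchy_kernel G) (- V) V).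
  { set (A := divisor_steps t).
    apply Rle_trans with
      (RInt (fun u => I2 (t + u) * gauss_kernel G u - A * gauss_kernel G u) (- V) V).
    - rewrite RInt_minus_R by (assumption || now apply ex_RInt_scal_R).
      rewrite RInt_scal_R, RInt_gauss_kernel by (assumption || lra). lra.
    - unfold X. rewrite <- !RInt_scal_R by assumption.
      rewrite <- RInt_plus_R by now apply ex_RInt_scal_R.
      apply RInt_le; [lra| |apply ex_RInt_plus_R; now apply ex_RInt_scal_R|].
      + apply (ex_RInt_minus (V := R_NormedModule)); [exact exI|now apply ex_RInt_scal_R].
      + intros u hu.
        assert (hu' : Rabs u <= V) by (apply Rabs_le_between; lra).
        assert (hv := hvar T G t u hL hT hG1 hG hGT ht hu').
        destruct (gauss_kernel_bound G u ltac:(lra)) as [hk1 hk2].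
        replace (I2 (t + u) * gauss_kernel G u - A * gauss_kernel G u) with
          (E_star (t + u) * gauss_kernel G u +
           (divisor_steps (t + u) - A) * gauss_kernel G u) by (rewrite E_star_eq; ring).
        apply Rplus_le_compat.
        * eapply Rle_trans; [apply Rle_abs|]. rewrite Rabs_mult.
          replace (4 / G * (Rabs (E_star (t + u)) * cauchy_kernel G u)) with
            (Rabs (E_star (t + u)) * (4 / G * cauchy_kernel G u)) by ring.
          apply Rmult_le_compat_l; [apply Rabs_pos|exact hk1].
        * eapply Rle_trans; [apply Rle_abs|]. rewrite Rabs_mult.
          apply Rle_trans with (C * (Rabs u + G) * L ^ 2 * Rabs (gauss_kernel G u)).
          -- apply Rmult_le_compat_r; [apply Rabs_pos|exact hv].
          -- replace (C * (Rabs u + G) * L ^ 2 * Rabs (gauss_kernel G u)) with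
               (C * L ^ 2 * ((Rabs u + G) * Rabs (gauss_kernel G u))) by ring.
             replace (12 * C * L ^ 2 * cauchy_kernel G u) with
               (C * L ^ 2 * (12 * cauchy_kernel G u)) by ring.
             apply Rmult_le_compat_l; [|exact hk2].
             apply Rmult_le_pos; [lra|apply pow2_ge_0]. }
  assert (hK := RInt_cauchy_kernel G V ltac:(lra) hV).
  assert (hL2 : 1 <= L ^ 2) by nra.
  assert (hsm : smoothed G t <= G * (4 / G ^ 2 * X + (8480 + 48 * C) * L ^ 2)).
  { replace (G * (4 / G ^ 2 * X + (8480 + 48 * C) * L ^ 2)) with
      (4 / G * X + 8480 * G * L ^ 2 + 12 * C * L ^ 2 * (4 * G)) by (field; lra).
    assert (12 * C * L ^ 2 * RInt (cauchy_kernel G) (- V) V <= 12 * C * L ^ 2 * (4 * G)) by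
      (apply Rmult_le_compat_l; [apply Rmult_le_pos; lra|apply hK]).
    assert (8480 * G * 1 <= 8480 * G * L ^ 2) by (apply Rmult_le_compat_l; lra).
    lra. }
  rewrite J1_eq.
  assert (hsp : 1 <= sqrt PI).
  { rewrite <- sqrt_1; apply sqrt_le_1_alt. assert (h := PI2_1); lra. }
  assert (h0 := smoothed_nonneg G t ltac:(lra)).
  apply Rle_trans with (/ G * smoothed G t).
  - apply Rmult_le_compat_r; [exact h0|]. apply Rinv_le_contravar; nra.
  - apply (Rmult_le_reg_l G); [lra|]. rewrite <- Rmult_assoc, Rinv_r, Rmult_1_l by lra.
    exact hsm.
Qed.

(** * The moment inequality *)

Lemma ex_RInt_E_star_rpow (m a b : R) : 1 <= m ->
  ex_RInt (fun s => rpow (Rabs (E_star s)) m) a b.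
Proof.
  intros hm. apply (ex_RInt_ext (fun s => rpow (Rabs (E_star s)) m * 1)).
  - intros; apply Rmult_1_r.
  - apply (ex_RInt_E_star (fun x => rpow (Rabs x) m) (fun _ => 1));
      [intros; now apply continuous_rpow_abs|intros; apply continuous_const].
Qed.

Lemma J1_nonneg (t G : R) : 0 < G -> 0 <= J1 t G.
Proof.
  intros hG; rewrite J1_eq; apply Rmult_le_pos; [|now apply smoothed_nonneg].
  apply Rlt_le, Rinv_0_lt_compat, Rmult_lt_0_compat; [apply sqrt_lt_R0, PI_RGT_0|exact hG].
Qed.

Lemma continuous_rpow_J1 (m G t : R) : 1 <= m -> 0 < G ->
  continuous (fun t => rpow (J1 t G) m) t.
Proof.
  intros hm hG.
  apply (continuous_ext (fun t => rpow (Rabs (/ (sqrt PI * G) * smoothed G t)) m)).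
  - intros s; rewrite <- J1_eq, Rabs_right; [reflexivity|apply Rle_ge, J1_nonneg, hG].
  - apply (continuous_comp (fun t => / (sqrt PI * G) * smoothed G t)
      (fun x => rpow (Rabs x) m)); [|now apply continuous_rpow_abs].
    apply (continuous_mult (fun _ => / (sqrt PI * G)) (smoothed G));
      [apply continuous_const|now apply continuous_smoothed_t].
Qed.

(** Jensen with the Cauchy kernel of mass at most 4 G yields (4 / G^2)^m (4 G)^(m-1) = 4^(2m-1)
    G^(-1-m), the power of G in the theorem. The kernel left in the integral is then bounded by
    1. *)
Lemma rpow_J1_pointwise (m eps c : R) : 1 <= m -> 0 < eps -> 0 < c -> exists K, 0 < K /\
  forall T G t, 20 <= ln T -> 0 < T -> 1 <= G -> c * Rpower T eps <= G -> G <= T ->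
  T <= t <= 2 * T ->
  rpow (J1 t G) m <= K * (Rpower G (- 1 - m) *
    RInt (fun u => rpow (Rabs (E_star (t + u))) m) (- (G * ln T)) (G * ln T)
    + Rpower (ln T) (2 * m)).
Proof.
  intros hm heps hc.
  destruct (J1_pointwise eps c heps hc) as (C & hC & hJ).
  set (K1 := Rpower 4 (2 * m - 1)). set (K2 := Rpower C m). set (K0 := Rpower 2 m).
  assert (hK0 : 0 < K0) by apply exp_pos.
  assert (hK1 : 0 < K1) by apply exp_pos.
  assert (hK2 : 0 < K2) by apply exp_pos.
  exists (K0 * (K1 + K2)); split; [apply Rmult_lt_0_compat; lra|].
  intros T G t hL hT hG1 hG hGT ht.
  specialize (hJ T G t hL hT hG1 hG hGT ht).
  set (L := ln T) in *. set (V := G * L) in *.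
  assert (hV : 0 < V) by (unfold V; nra).
  set (X := RInt (fun u => Rabs (E_star (t + u)) * cauchy_kernel G u) (- V) V) in *.
  set (P := RInt (fun u => rpow (Rabs (E_star (t + u))) m) (- V) V).
  assert (exX : ex_RInt (fun u => Rabs (E_star (t + u)) * cauchy_kernel G u) (- V) V).
  { apply (ex_RInt_E_star_shift Rabs (cauchy_kernel G));
      [apply continuous_Rabs|apply continuous_cauchy_kernel]. }
  assert (exP : ex_RInt (fun u => rpow (Rabs (E_star (t + u))) m) (- V) V).
  { apply (ex_RInt_shift (fun s => rpow (Rabs (E_star s)) m)); now apply ex_RInt_E_star_rpow. }
  assert (exPk : ex_RInt (fun u => rpow (Rabs (E_star (t + u))) m * cauchy_kernel G u) (- V) V).
  { apply (ex_RInt_E_star_shift (fun x => rpow (Rabs x) m) (cauchy_kernel G));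
      [intros; now apply continuous_rpow_abs|apply continuous_cauchy_kernel]. }
  assert (hX : 0 <= X).
  { apply RInt_ge_0; [lra|exact exX|].
    intros; apply Rmult_le_pos; [apply Rabs_pos|apply Rlt_le, cauchy_kernel_pos]. }
  assert (hP : 0 <= P) by (apply RInt_ge_0; [lra|exact exP|intros; apply rpow_nonneg]).
  assert (hM := RInt_cauchy_kernel G V ltac:(lra) hV).
  assert (hXm : rpow X m <= Rpower (4 * G) (m - 1) * P).
  { eapply Rle_trans; [apply (jensen_rpow (fun u => Rabs (E_star (t + u))) (cauchy_kernel G))|].
    - exact hm.
    - lra.
    - intros; apply Rabs_pos.
    - intros; apply Rlt_le, cauchy_kernel_pos.
    - apply ex_RInt_cont, continuous_cauchy_kernel.
    - apply hM.
    - exact exX.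
    - exact exPk.
    - apply Rmult_le_compat.
      + apply Rlt_le, exp_pos.
      + apply RInt_ge_0; [lra|exact exPk|].
        intros; apply Rmult_le_pos; [apply rpow_nonneg|apply Rlt_le, cauchy_kernel_pos].
      + apply Rle_Rpower_l; [lra|exact hM].
      + apply RInt_le; [lra|exact exPk|exact exP|].
        intros u _. assert (h := cauchy_kernel_pos G u).
        assert (h1 := rpow_nonneg (Rabs (E_star (t + u))) m). nra. }
  assert (hc4 : 0 < 4 / G ^ 2) by (apply Rdiv_lt_0_compat; nra).
  assert (hL2 : 0 < L ^ 2) by nra.
  eapply Rle_trans; [apply rpow_mono; [exact hm|split; [apply J1_nonneg; lra|exact hJ]]|].
  eapply Rle_trans; [apply rpow_plus_le; [exact hm| |]|].
  - apply Rmult_le_pos; lra.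
  - apply Rmult_le_pos; lra.
  - fold K0. rewrite Rmult_assoc; apply Rmult_le_compat_l; [lra|].
    rewrite rpow_mult_pos by lra.
    assert (h1 : Rpower (4 / G ^ 2) m * rpow X m <= K1 * (Rpower G (- 1 - m) * P)).
    { apply Rle_trans with (Rpower (4 / G ^ 2) m * (Rpower (4 * G) (m - 1) * P)).
      - apply Rmult_le_compat_l; [apply Rlt_le, exp_pos|exact hXm].
      - rewrite <- !Rmult_assoc. apply Rmult_le_compat_r; [exact hP|]. right.
        unfold K1, Rpower. rewrite <- !exp_plus; f_equal.
        unfold Rdiv. rewrite (ln_mult 4 (/ G ^ 2)), ln_Rinv, ln_pow, (ln_mult 4 G)
          by (try apply Rinv_0_lt_compat; nra).
        simpl INR. ring. }
    assert (h2 : rpow (C * L ^ 2) m = K2 * Rpower L (2 * m)).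
    { rewrite rpow_mult_pos by lra. rewrite rpow_pos by assumption. fold K2; f_equal.
      unfold Rpower; f_equal. rewrite ln_pow by lra. simpl INR; ring. }
    rewrite h2.
    assert (h3 : 0 <= Rpower G (- 1 - m) * P) by
      (apply Rmult_le_pos; [apply Rlt_le, exp_pos|exact hP]).
    assert (h4 : 0 < Rpower L (2 * m)) by apply exp_pos.
    nra.
Qed.

Theorem theorem2 :
  forall (m eps c : R), 1 <= m -> 0 < eps -> 0 < c ->
  exists (C T0 : R), 0 < C /\
    forall (T G : R), T0 <= T -> c * Rpower T eps <= G -> G <= T ->
      RInt (fun t => rpow (J1 t G) m) T (2 * T)
      <= C * ( rpow G (- 1 - m) *
               RInt (fun x => RInt (fun t => rpow (Rabs (E_star (t + x))) m) T (2 * T))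
                    (- (G * ln T)) (G * ln T)
               + T * rpow (ln T) (2 * m) ).
Proof.
  intros m eps c hm heps hc.
  destruct (rpow_J1_pointwise m eps c hm heps hc) as (K & hK & hJ).
  (* This threshold yields both ln T >= 20 and c T^eps >= 1, hence G >= 1. *)
  exists K, (exp (20 + Rabs (ln c) / eps)); split; [exact hK|].
  intros T G hT0 hG hGT.
  assert (hT : 0 < T) by (eapply Rlt_le_trans; [apply exp_pos|exact hT0]).
  assert (hq : 0 <= Rabs (ln c) / eps) by (apply Rle_mult_inv_pos; [apply Rabs_pos|exact heps]).
  assert (hL0 : 20 + Rabs (ln c) / eps <= ln T).
  { rewrite <- (ln_exp (20 + Rabs (ln c) / eps)); apply ln_le; [apply exp_pos|exact hT0]. }
  assert (hL : 20 <= ln T) by lra.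
  assert (hG1 : 1 <= G).
  { eapply Rle_trans; [|exact hG]. rewrite <- (exp_ln c) by assumption. unfold Rpower.
    rewrite <- exp_plus, <- exp_0; apply exp_le_compat.
    assert (h1 : Rabs (ln c) <= eps * ln T).
    { replace (Rabs (ln c)) with (eps * (Rabs (ln c) / eps)) by (field; lra). nra. }
    assert (h2 := Rle_abs (- ln c)). rewrite Rabs_Ropp in h2. lra. }
  rewrite (rpow_pos G), (rpow_pos (ln T)) by lra.
  set (phi := fun s => rpow (Rabs (E_star s)) m).
  assert (hphi : forall a b, ex_RInt phi a b) by (intros; now apply ex_RInt_E_star_rpow).
  (* With t as the outer variable, the pointwise bound can be integrated directly. *)
  rewrite <- (RInt_window_swap phi T (2 * T)) by exact hphi.
  set (P := fun t => RInt (fun u => phi (t + u)) (- (G * ln T)) (G * ln T)).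
  assert (exP : ex_RInt P T (2 * T)).
  { apply ex_RInt_cont; intros; now apply continuous_window. }
  apply Rle_trans with (RInt (fun t => K * (Rpower G (- 1 - m) * P t +
    Rpower (ln T) (2 * m))) T (2 * T)).
  - apply RInt_le; [lra| | |].
    + apply ex_RInt_cont; intros; apply continuous_rpow_J1; lra.
    + apply ex_RInt_scal_R, ex_RInt_plus_R; [now apply ex_RInt_scal_R|apply ex_RInt_const_R].
    + intros t ht; apply hJ; try assumption; lra.
  - rewrite RInt_scal_R, RInt_plus_R, RInt_scal_R, RInt_const_R;
      try assumption; try apply ex_RInt_const_R; try now apply ex_RInt_scal_R.
    + right; ring.
    + apply ex_RInt_plus_R; [now apply ex_RInt_scal_R|apply ex_RInt_const_R].
Qed.
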